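(* For any $n,g\ge 0$ there is an effective algorithm to compute the Poisson bi-vector of the character variety $\mathfrak{X}_{n,g}(\mathrm{SL}(2,\mathbb{C}))$. For the five-holed sphere $\Sigma_{5,0}$ (suitably oriented) the Poisson bi-vector of $\mathfrak{X}_{5,0}(\mathrm{SL}(2,\mathbb{C}))$ is \begin{align*} \mathfrak{a}_{5,0}(\mathrm{SL}(2,\mathbb{C}))=\ &\mathfrak{a}_{1324}\frac{\partial}{\partial t_{\{1,3\}}}\wedge\frac{\partial}{\partial t_{\{2,4\}}}+\Sigma_1\Big(\mathfrak{a}_{1214}\frac{\partial}{\partial t_{\{1,2\}}}\wedge\frac{\partial}{\partial t_{\{1,4\}}}\Big)\\ &+\Sigma_2\Big(\mathfrak{a}_{12314}\frac{\partial}{\partial t_{\{1,2,3\}}}\wedge\frac{\partial}{\partial t_{\{1,4\}}}+\mathfrak{a}_{12324}\frac{\partial}{\partial t_{\{1,2,3\}}}\wedge\frac{\partial}{\partial t_{\{2,4\}}}+\mathfrak{a}_{12334}\frac{\partial}{\partial t_{\{1,2,3\}}}\wedge\frac{\partial}{\partial t_{\{3,4\}}}\Big)\\ &+\Sigma_2\Big(\mathfrak{a}_{123124}\frac{\partial}{\partial t_{\{1,2,3\}}}\wedge\frac{\partial}{\partial t_{\{1,2,4\}}}\Big)+\Sigma_3\Big(\mathfrak{a}_{123134}\frac{\partial}{\partial t_{\{1,2,3\}}}\wedge\frac{\partial}{\partial t_{\{1,3,4\}}}\Big), \end{align*} where the symmetry operators $\Sigma_1,\Sigma_2,\Sigma_3$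 and the polynomials $\mathfrak{a}_x$ are those given explicitly in the context.
   Context: $\Sigma_{n,g}$ is the compact connected oriented surface of genus $g$ with $n$ boundary components, and $\mathfrak{X}_{n,g}(\mathrm{SL}(2,\mathbb{C}))=\mathrm{Hom}(\pi_1(\Sigma_{n,g}),\mathrm{SL}(2,\mathbb{C}))/\!\!/\mathrm{SL}(2,\mathbb{C})$ is the GIT quotient by conjugation. Its coordinate ring is generated by finitely many trace functions $\mathrm{tr}_\alpha([\rho])=\mathrm{tr}(\rho(\alpha))$ and carries the Goldman Poisson bracket, the derivation in each argument determined by $$\{\mathrm{tr}(\rho(\alpha)),\mathrm{tr}(\rho(\beta))\}=\sum_{p\in\alpha\cap\beta}\epsilon(p,\alpha,\beta)\Big(\mathrm{tr}(\rho(\alpha_p\beta_p))-\tfrac12\mathrm{tr}(\rho(\alpha))\mathrm{tr}(\rho(\beta))\Big),$$ where $\alpha,\beta$ are represented by loops meeting only in transverse double points, $\epsilon(p,\alpha,\beta)=\pm1$ is the oriented intersection number, and $\alpha_p,\beta_p\in\pi_1(\Sigma_{n,g},p)$ are the loops based at $p$. Reversing the orientation of the surface changes the sign of the bracket. The bi-vector, in terms of a chosen finite list of generators $z_1,\dots,z_N$ of the coordinate ring, is the expression $\sum_{i<j}\{z_i,z_j\}\frac{\partial}{\partial z_i}\wedge\frac{\partial}{\partial z_j}$ with each $\{z_i,z_j\}$ written as a polynomial in the generators; here $\frac{\partial}{\partial z_i}\wedge\frac{\partial}{\partial z_j}=-\frac{\partial}{\partial z_j}\wedge\frac{\partial}{\partial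 z_i}$, and pairs not appearing have bracket zero. An algorithm to compute it is effective if it terminates after finitely many steps (each of which can in principle be done by hand) and always outputs a correct answer. For $\Sigma_{5,0}$: $\pi_1(\Sigma_{5,0})=\langle c_1,\dots,c_5\mid c_1c_2c_3c_4c_5=1\rangle$, $c_i$ being freely homotopic to the $i$-th boundary circle with its boundary orientation; the group is free on $c_1,\dots,c_4$. The generators used are the 14 functions $t_{\{i\}}=\mathrm{tr}_{c_i}$ ($1\le i\le4$), $t_{\{i,j\}}=\mathrm{tr}_{c_ic_j}$ ($1\le i<j\le4$), $t_{\{i,j,k\}}=\mathrm{tr}_{c_ic_jc_k}$ ($1\le i<j<k\le4$). Symmetry operators. For a permutation $\sigma$ of $\{1,2,3,4\}$ (cycle notation), $\mu_\sigma$ acts on expressions by replacing every $t_I$ by $t_{\sigma(I)}$ and every $\frac{\partial}{\partial t_I}$ by $\frac{\partial}{\partial t_{\sigma(I)}}$, for index sets $I$ (it corresponds to permuting boundary components). Put $\Sigma_1=\mu_{(1)}+\mu_{(34)}+\mu_{(23)}+\mu_{(123)}+\mu_{(124)}+\mu_{(142)}+\mu_{(143)}+\mu_{(13)(24)}+\mu_{(1234)}+\mu_{(1342)}+\mu_{(1324)}+\mu_{(1432)}$, $\Sigma_2=\mu_{(1)}+\mu_{(1234)}+\mu_{(13)(24)}+\mu_{(1432)}$, $\Sigma_3=\mu_{(1)}+\mu_{(1432)}$, where $(1)$ is the identity. Polynomials. \begin{align*} \mathfrak{a}_{1324}=\ &t_{\{3\}}t_{\{4\}}t_{\{1,2\}}-2t_{\{3,4\}}t_{\{1,2\}}-t_{\{2\}}t_{\{3\}}t_{\{1,4\}}-t_{\{1\}}t_{\{4\}}t_{\{2,3\}}+2t_{\{1,4\}}t_{\{2,3\}}+t_{\{1\}}t_{\{2\}}t_{\{3,4\}},\\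 \mathfrak{a}_{1214}=\ &t_{\{1,2\}}t_{\{1,4\}}+2t_{\{2,4\}}-t_{\{1\}}t_{\{1,2,4\}}-t_{\{2\}}t_{\{4\}},\\ \mathfrak{a}_{12314}=\ &\tfrac12t_{\{4\}}t_{\{1\}}^2t_{\{2,3\}}+\tfrac12t_{\{2\}}t_{\{1\}}^2t_{\{3,4\}}-\tfrac12t_{\{1\}}^2t_{\{2,3,4\}}+\tfrac12t_{\{3\}}t_{\{4\}}t_{\{1\}}t_{\{1,2\}}+\tfrac12t_{\{2\}}t_{\{3\}}t_{\{1\}}t_{\{1,4\}}\\ &-\tfrac12t_{\{1\}}t_{\{1,4\}}t_{\{2,3\}}+\tfrac12t_{\{1\}}t_{\{1,3\}}t_{\{2,4\}}-\tfrac12t_{\{1\}}t_{\{1,2\}}t_{\{3,4\}}-\tfrac12t_{\{4\}}t_{\{1\}}t_{\{1,2,3\}}-\tfrac12t_{\{3\}}t_{\{1\}}t_{\{1,2,4\}}\\ &-\tfrac12t_{\{2\}}t_{\{1\}}t_{\{1,3,4\}}-t_{\{4\}}t_{\{2,3\}}+t_{\{1,4\}}t_{\{1,2,3\}}+2t_{\{2,3,4\}}-\tfrac12t_{\{2\}}t_{\{3\}}t_{\{4\}}t_{\{1\}}^2,\\ \mathfrak{a}_{12324}=\ &-t_{\{3\}}t_{\{1,4\}}+t_{\{1\}}t_{\{3,4\}}+t_{\{2,3\}}t_{\{1,2,4\}}-t_{\{1,2\}}t_{\{2,3,4\}},\\ \mathfrak{a}_{12334}=\ &-\tfrac12t_{\{4\}}t_{\{3\}}^2t_{\{1,2\}}-\tfrac12t_{\{2\}}t_{\{3\}}^2t_{\{1,4\}}+\tfrac12t_{\{3\}}^2t_{\{1,2,4\}}-\tfrac12t_{\{1\}}t_{\{4\}}t_{\{3\}}t_{\{2,3\}}+\tfrac12t_{\{3\}}t_{\{1,4\}}t_{\{2,3\}}\\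 &-\tfrac12t_{\{3\}}t_{\{1,3\}}t_{\{2,4\}}-\tfrac12t_{\{1\}}t_{\{2\}}t_{\{3\}}t_{\{3,4\}}+\tfrac12t_{\{3\}}t_{\{1,2\}}t_{\{3,4\}}+\tfrac12t_{\{4\}}t_{\{3\}}t_{\{1,2,3\}}+\tfrac12t_{\{2\}}t_{\{3\}}t_{\{1,3,4\}}\\ &+\tfrac12t_{\{1\}}t_{\{3\}}t_{\{2,3,4\}}+t_{\{4\}}t_{\{1,2\}}-t_{\{3,4\}}t_{\{1,2,3\}}-2t_{\{1,2,4\}}+\tfrac12t_{\{1\}}t_{\{2\}}t_{\{4\}}t_{\{3\}}^2,\\ \mathfrak{a}_{123124}=\ &\tfrac12t_{\{3\}}t_{\{4\}}t_{\{1,2\}}^2-\tfrac12t_{\{3,4\}}t_{\{1,2\}}^2-\tfrac12t_{\{1\}}t_{\{2\}}t_{\{3\}}t_{\{4\}}t_{\{1,2\}}+\tfrac12t_{\{2\}}t_{\{3\}}t_{\{1,4\}}t_{\{1,2\}}+\tfrac12t_{\{1\}}t_{\{4\}}t_{\{2,3\}}t_{\{1,2\}}\\ &-\tfrac12t_{\{1,4\}}t_{\{2,3\}}t_{\{1,2\}}+\tfrac12t_{\{1,3\}}t_{\{2,4\}}t_{\{1,2\}}+\tfrac12t_{\{1\}}t_{\{2\}}t_{\{3,4\}}t_{\{1,2\}}-\tfrac12t_{\{4\}}t_{\{1,2,3\}}t_{\{1,2\}}-\tfrac12t_{\{3\}}t_{\{1,2,4\}}t_{\{1,2\}}\\ &-\tfrac12t_{\{2\}}t_{\{1,3,4\}}t_{\{1,2\}}-\tfrac12t_{\{1\}}t_{\{2,3,4\}}t_{\{1,2\}}+2t_{\{3,4\}}+t_{\{1,2,3\}}t_{\{1,2,4\}}-t_{\{3\}}t_{\{4\}},\\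 \mathfrak{a}_{123134}=\ &\tfrac12t_{\{2,4\}}t_{\{1,3\}}^2-\tfrac12t_{\{1\}}t_{\{2\}}t_{\{3\}}t_{\{4\}}t_{\{1,3\}}+\tfrac12t_{\{3\}}t_{\{4\}}t_{\{1,2\}}t_{\{1,3\}}+\tfrac12t_{\{2\}}t_{\{3\}}t_{\{1,4\}}t_{\{1,3\}}+\tfrac12t_{\{1\}}t_{\{4\}}t_{\{2,3\}}t_{\{1,3\}}\\ &-\tfrac12t_{\{1,4\}}t_{\{2,3\}}t_{\{1,3\}}+\tfrac12t_{\{1\}}t_{\{2\}}t_{\{3,4\}}t_{\{1,3\}}-\tfrac12t_{\{1,2\}}t_{\{3,4\}}t_{\{1,3\}}-\tfrac12t_{\{4\}}t_{\{1,2,3\}}t_{\{1,3\}}-\tfrac12t_{\{3\}}t_{\{1,2,4\}}t_{\{1,3\}}\\ &-\tfrac12t_{\{2\}}t_{\{1,3,4\}}t_{\{1,3\}}-\tfrac12t_{\{1\}}t_{\{2,3,4\}}t_{\{1,3\}}-2t_{\{2,4\}}-2t_{\{2,3\}}t_{\{3,4\}}+t_{\{1,2,3\}}t_{\{1,3,4\}}+2t_{\{3\}}t_{\{2,3,4\}}+t_{\{2\}}t_{\{4\}}. \end{align*} *)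

(* Defs.v *)
(* The field of complex numbers is [complex R], for [R : realType]. *)
From mathcomp Require Import all_boot all_order all_algebra.
From mathcomp Require Import reals.
From mathcomp Require Import complex.

Set Implicit Arguments.
Unset Strict Implicit.
Unset Printing Implicit Defensive.

Import Order.TTheory GRing.Theory Num.Theory.
Local Open Scope ring_scope.

(* The surface Sigma_{n,g}.  Let D be the closed lower half-plane together with
   the point at infinity, a disc, with the orientation of the plane.  Attach to
   D one untwisted band for every element of [band n g]: bands a_i and b_i
   (i < g) and c_j (j < n).  The two ends of the band x, its tail and its head,
   are glued to the intervals [tail x, tail x + 1] and [head x, head x + 1] of
   the boundary line of D (up to shrinking); the point at offset t of the tail
   is joined, along the band, to the point at offset 1 - t of the head.  From
   left to right the ends are
     tail a_i, head b_i, head a_i, tail b_i (i = 0, .., g-1),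
     then tail c_j, head c_j (j = 0, .., n-1).
   The result has n + 1 boundary circles: one between the two ends of each c_j,
   and an outer one, which is capped off by a disc.  This is the compact
   connected oriented surface of genus g with n boundary circles (its Euler
   characteristic is 1 - (2g + n) + 1).  *)
Definition band (n g : nat) : finType := ('I_g + 'I_g + 'I_n)%type.

Definition band_a (n g : nat) (i : 'I_g) : band n g := inl (inl i).
Definition band_b (n g : nat) (i : 'I_g) : band n g := inl (inr i).
Definition band_c (n g : nat) (j : 'I_n) : band n g := inr j.

Definition tail (n g : nat) (x : band n g) : nat :=
  match x with
  | inl (inl i) => 4 * i
  | inl (inr i) => 4 * i + 3
  | inr j => 4 * g + 2 * j
  end%N.

Definition head (n g : nat) (x : band n g) : nat :=
  match x with
  | inl (inl i) => 4 * i + 2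
  | inl (inr i) => 4 * i + 1
  | inr j => 4 * g + 2 * j + 1
  end%N.

(* The letter (x, true) stands for the loop based in D that runs once along the
   band x, leaving D at the tail and coming back at the head; (x, false) is its
   inverse.  In a word, and in products of loops, the leftmost loop is run
   first. *)
Definition letter (n g : nat) : Type := (band n g * bool)%type.
Definition word (n g : nat) : Type := seq (letter n g).

(* The outer boundary circle of D with its bands, read from left to right, is
   prod_i [a_i, b_i] prod_j c_j.  By van Kampen, capping it off yields
   pi_1 = < a_i, b_i, c_j | prod_i [a_i, b_i] prod_j c_j = 1 >.
   The loop c_j is freely homotopic to the j-th boundary circle, which has the
   surface on its left for the orientation of the plane. *)
Definition relator (n g : nat) : word n g :=
  flatten [seq [:: (band_a n i, true); (band_b n i, true);
                   (band_a n i, false); (band_b n i, false)] | i <- enum 'I_g]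
  ++ [seq (band_c g j, true) | j <- enum 'I_n].

Definition word_mx (R : realType) (n g : nat)
    (rho : band n g -> 'M[complex R]_2) (w : word n g) : 'M[complex R]_2 :=
  \big[mulmx/1%:M]_(l <- w) (if l.2 then rho l.1 else invmx (rho l.1)).

(* Hom(pi_1(Sigma_{n,g}), SL(2,C)), through the presentation above. *)
Record rep (R : realType) (n g : nat) := Rep {
  rep_mx :> band n g -> 'M[complex R]_2;
  rep_det : forall x, \det (rep_mx x) = 1;
  rep_relator : word_mx rep_mx (relator n g) = 1%:M }.

Definition rfun (R : realType) (n g : nat) : Type := rep R n g -> complex R.

Definition tr (R : realType) (n g : nat) (w : word n g) : rfun R n g :=
  fun rho => \tr (word_mx rho w).

Inductive generated (R : realType) (T : Type) (S : (T -> complex R) -> Prop) :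
    (T -> complex R) -> Prop :=
| gen_in f : S f -> generated S f
| gen_const c : generated S (fun _ => c)
| gen_add f h : generated S f -> generated S h -> generated S (fun x => f x + h x)
| gen_mul f h : generated S f -> generated S h -> generated S (fun x => f x * h x).

Definition regular (R : realType) (n g : nat) (f : rfun R n g) : Prop :=
  generated (fun e => exists (x : band n g) (i j : 'I_2),
                        e = fun rho : rep R n g => rho x i j) f.

Definition conj_invariant (R : realType) (n g : nat) (f : rfun R n g) : Prop :=
  forall (rho rho' : rep R n g) (P : 'M[complex R]_2),
    \det P = 1 -> (forall x, rho' x = P *m rho x *m invmx P) -> f rho' = f rho.

(* The coordinate ring of the GIT quotient Hom(pi_1, SL(2,C)) // SL(2,C). *)
Definition coord_ring (R : realType) (n g : nat) (f : rfun R n g) : Prop :=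
  regular f /\ conj_invariant f.

(* A loop in general position, up to isotopy, is a cyclic sequence of strands.
   The strand (l, t) runs along the band l.1 in the direction given by l.2,
   parallel to its sides, starting or ending at offset t of the tail.  The loop
   goes inside D from the end point of each strand to the starting point of the
   next one along a half-circle (chord).  Every pair of free homotopy classes
   is represented by such loops, and the capping disc is avoided. *)
Definition strand (n g : nat) : Type := (letter n g * rat)%type.
Definition loop (n g : nat) : Type := seq (strand n g).

Definition loop_word (n g : nat) (u : loop n g) : word n g := [seq s.1 | s <- u].

Definition tail_pt (n g : nat) (s : strand n g) : rat := (tail s.1.1)%:R + s.2.
Definition head_pt (n g : nat) (s : strand n g) : rat := (head s.1.1)%:R + (1 - s.2).

(* where the strand leaves D, and where it comes back to D *)
Definition exit_pt (n g : nat) (s : strand n g) : rat :=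
  if s.1.2 then tail_pt s else head_pt s.
Definition entry_pt (n g : nat) (s : strand n g) : rat :=
  if s.1.2 then head_pt s else tail_pt s.

(* The chords of u: the i-th one follows the i-th strand. *)
Definition chords (n g : nat) (u : loop n g) : seq (rat * rat) :=
  [seq (entry_pt st.1, exit_pt st.2) | st <- zip u (rot 1 u)].

(* For the orientation of the plane, the boundary point x of D is on the left of
   the oriented half-circle of the lower half-plane from d.1 to d.2. *)
Definition on_left (d : rat * rat) (x : rat) : bool :=
  if d.1 < d.2 then d.1 < x < d.2 else ~~ (d.2 < x < d.1).

(* Two half-circles with four distinct end points meet at most once, and then
   transversally: they meet iff the end points of the second one lie on
   different sides of the first one.  The sign of the intersection is +1 iff
   (velocity of d, velocity of d') is a direct basis of the plane, i.e. iff d'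
   crosses d from right to left; the value is 0 if d and d' are disjoint. *)
Definition chord_sign (d d' : rat * rat) : int :=
  (on_left d d'.2)%:Z - (on_left d d'.1)%:Z.

Definition in_band (n g : nat) (s : strand n g) : bool := 0 < s.2 < 1.

(* No two strands of u and v run along the same arc of a band. *)
Definition general_position (n g : nat) (u v : loop n g) : bool :=
  all (@in_band n g) (u ++ v) && uniq [seq (s.1.1, s.2) | s <- u ++ v].

(* The right-hand side of the product formula.  The bands carry no
   intersection.  If p is the intersection of the i-th chord of u and of the
   j-th chord of v, the loop u_p based at p first runs along the strands
   i+1, i+2, .., of u and ends with the strand i; likewise for v_p.
   [o = true] is the orientation of the plane, [o = false] the opposite one. *)
Definition goldman_sum (R : realType) (n g : nat) (o : bool) (u v : loop n g) :
    rfun R n g := fun rho =>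
  \sum_(i < size u) \sum_(j < size v)
    ((if o then 1 else -1)
       * chord_sign (nth (0, 0) (chords u) i) (nth (0, 0) (chords v) j))%:~R
    * (tr (loop_word (rot i.+1 u) ++ loop_word (rot j.+1 v)) rho
       - 2^-1 * tr (loop_word u) rho * tr (loop_word v) rho).

(* B is the Goldman Poisson bracket on the coordinate ring of the character
   variety of the surface oriented by o.  Since this ring is generated by trace
   functions, at most one bracket on it satisfies these conditions; values of B
   outside the coordinate ring are irrelevant. *)
Record goldman_bracket (R : realType) (n g : nat) (o : bool)
    (B : rfun R n g -> rfun R n g -> rfun R n g) : Prop := GoldmanBracket {
  goldman_coord : forall f h,
    coord_ring f -> coord_ring h -> coord_ring (B f h);
  goldman_linear : forall (c : complex R) f f' h,
    coord_ring f -> coord_ring f' -> coord_ring h ->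
    forall rho, B (fun x => c * f x + f' x) h rho = c * B f h rho + B f' h rho;
  goldman_anti : forall f h, coord_ring f -> coord_ring h ->
    forall rho, B f h rho = - B h f rho;
  goldman_leibniz : forall f f' h,
    coord_ring f -> coord_ring f' -> coord_ring h ->
    forall rho, B (fun x => f x * f' x) h rho = f rho * B f' h rho + B f h rho * f' rho;
  goldman_jacobi : forall f f' h,
    coord_ring f -> coord_ring f' -> coord_ring h ->
    forall rho, B f (B f' h) rho + B f' (B h f) rho + B h (B f f') rho = 0;
  goldman_trace : forall u v : loop n g, general_position u v ->
    forall rho, B (tr (loop_word u)) (tr (loop_word v)) rho = goldman_sum o u v rho }.

(* Formal polynomials with rational coefficients in variables z_i (i : I): the
   pair (q, [:: i1; ..; ik]) is the term q * z_i1 * .. * z_ik. *)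
Definition fpoly (I : Type) : Type := seq (rat * seq I).

Definition eval_fpoly (R : realType) (n g : nat) (I : Type) (z : I -> rfun R n g)
    (p : fpoly I) : rfun R n g := fun rho =>
  \sum_(m <- p) ratr m.1 * \prod_(i <- m.2) z i rho.

(* Formal bi-vectors: (p, (i, j)) is the term p d/dz_i /\ d/dz_j. *)
Definition bivector (I : Type) : Type := seq (fpoly I * (I * I)).

(* The coefficient of d/dz_i /\ d/dz_j, using antisymmetry of the wedge. *)
Definition bivector_coef (R : realType) (n g : nat) (I : eqType)
    (z : I -> rfun R n g) (e : bivector I) (i j : I) : rfun R n g := fun rho =>
  \sum_(t <- e) ((t.2 == (i, j))%:R - (t.2 == (j, i))%:R) * eval_fpoly z t.1 rho.

(* e is the Poisson bi-vector of the character variety in terms of the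
   generators z_i, i in s, of the coordinate ring. *)
Definition poisson_bivector (R : realType) (n g : nat) (o : bool) (I : eqType)
    (s : seq I) (z : I -> rfun R n g) (e : bivector I) : Prop :=
  [/\ forall i, i \in s -> coord_ring (z i),
      forall f, coord_ring f -> generated (fun h => exists2 i, i \in s & h = z i) f
    & forall B, goldman_bracket o B ->
      forall i j, i \in s -> j \in s ->
      forall rho, B (z i) (z j) rho = bivector_coef z e i j rho].

(* Algorithms: while programs over binary trees, a Turing-complete model of
   computation. *)
Inductive tree : Type := Leaf | Node of tree & tree.

Inductive prog : Type :=
| PId
| PLeaf
| PNode of prog & prog
| PLeft
| PRight
| PSeq of prog & prog
| PIf of prog & prog & prog
| PWhile of prog & prog.

(* [run p x y]: on input x the program p terminates with output y. *)
Inductive run : prog -> tree -> tree -> Prop :=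
| run_id x : run PId x x
| run_leaf x : run PLeaf x Leaf
| run_node p q x y z : run p x y -> run q x z -> run (PNode p q) x (Node y z)
| run_left x y : run PLeft (Node x y) x
| run_left0 : run PLeft Leaf Leaf
| run_right x y : run PRight (Node x y) y
| run_right0 : run PRight Leaf Leaf
| run_seq p q x y z : run p x y -> run q y z -> run (PSeq p q) x z
| run_if_node b p q x l r y : run b x (Node l r) -> run p x y -> run (PIf b p q) x y
| run_if_leaf b p q x y : run b x Leaf -> run q x y -> run (PIf b p q) x y
| run_while_stop b p x : run b x Leaf -> run (PWhile b p) x x
| run_while_step b p x l r y z : run b x (Node l r) -> run p x y ->
    run (PWhile b p) y z -> run (PWhile b p) x z.

Fixpoint enc_nat (k : nat) : tree := if k is k'.+1 then Node Leaf (enc_nat k') else Leaf.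

Definition enc_bool (b : bool) : tree := enc_nat b.

Definition enc_int (m : int) : tree :=
  match m with
  | Posz k => Node Leaf (enc_nat k)
  | Negz k => Node (Node Leaf Leaf) (enc_nat k)
  end.

Definition enc_rat (q : rat) : tree := Node (enc_int (numq q)) (enc_int (denq q)).

Definition enc_pair (S T : Type) (f : S -> tree) (h : T -> tree) (x : S * T) : tree :=
  Node (f x.1) (h x.2).

Definition enc_seq (T : Type) (f : T -> tree) (s : seq T) : tree :=
  foldr (fun x t => Node (f x) t) Leaf s.

Definition enc_ord (k : nat) (i : 'I_k) : tree := enc_nat i.

Definition enc_band (n g : nat) (x : band n g) : tree :=
  match x with
  | inl (inl i) => Node (enc_nat 0) (enc_ord i)
  | inl (inr i) => Node (enc_nat 1) (enc_ord i)
  | inr j => Node (enc_nat 2) (enc_ord j)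
  end.

Definition enc_word (n g : nat) : word n g -> tree :=
  enc_seq (enc_pair (@enc_band n g) enc_bool).

Definition enc_bivector (I : Type) (f : I -> tree) : bivector I -> tree :=
  enc_seq (enc_pair (enc_seq (enc_pair enc_rat (enc_seq f))) (enc_pair f f)).

(* On input (n, g) the program outputs words w_0, .., w_(N-1) and a bi-vector in
   the generators tr_(w_i) of the coordinate ring. *)
Definition effective_bivector_algorithm (R : realType) (o : bool) (p : prog) : Prop :=
  forall n g : nat, exists (N : nat) (w : N.-tuple (word n g)) (e : bivector 'I_N),
    run p (Node (enc_nat n) (enc_nat g))
          (Node (enc_seq (@enc_word n g) w) (enc_bivector (@enc_ord N) e)) /\
    poisson_bivector o (enum 'I_N) (fun i => tr (tnth w i) : rfun R n g) e.

(* Five-holed sphere.  The index set I of t_I is the increasing sequence of its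
   elements, in {1, .., 4}; the boundary loop c_i is the band numbered i - 1. *)
Definition c50 (i : nat) : letter 5 0 := (band_c 0 (inord i.-1 : 'I_5), true).

Definition t50 (R : realType) (I : seq nat) : rfun R 5 0 :=
  tr [seq c50 i | i <- I].

Notation t1 := [:: 1%N].
Notation t2 := [:: 2%N].
Notation t3 := [:: 3%N].
Notation t4 := [:: 4%N].
Notation t12 := [:: 1%N; 2%N].
Notation t13 := [:: 1%N; 3%N].
Notation t14 := [:: 1%N; 4%N].
Notation t23 := [:: 2%N; 3%N].
Notation t24 := [:: 2%N; 4%N].
Notation t34 := [:: 3%N; 4%N].
Notation t123 := [:: 1%N; 2%N; 3%N].
Notation t124 := [:: 1%N; 2%N; 4%N].
Notation t134 := [:: 1%N; 3%N; 4%N].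
Notation t234 := [:: 2%N; 3%N; 4%N].

Definition index50 : seq (seq nat) :=
  [:: t1; t2; t3; t4; t12; t13; t14; t23; t24; t34; t123; t124; t134; t234].

Definition act (sigma : nat -> nat) (I : seq nat) : seq nat :=
  sort leq [seq sigma i | i <- I].

Definition mu (sigma : nat -> nat) (e : bivector (seq nat)) : bivector (seq nat) :=
  [seq ([seq (m.1, map (act sigma) m.2) | m <- t.1],
        (act sigma t.2.1, act sigma t.2.2)) | t <- e].

Definition cycles (s : seq (seq nat)) : nat -> nat :=
  foldr (fun c sigma => next c \o sigma) id s.

Definition sum_mu (S : seq (seq (seq nat))) (e : bivector (seq nat)) :
    bivector (seq nat) :=
  flatten [seq mu (cycles s) e | s <- S].

Definition Sigma1 : seq (seq (seq nat)) :=
  [:: [::];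
      [:: [:: 3; 4]];
      [:: [:: 2; 3]];
      [:: [:: 1; 2; 3]];
      [:: [:: 1; 2; 4]];
      [:: [:: 1; 4; 2]];
      [:: [:: 1; 4; 3]];
      [:: [:: 1; 3]; [:: 2; 4]];
      [:: [:: 1; 2; 3; 4]];
      [:: [:: 1; 3; 4; 2]];
      [:: [:: 1; 3; 2; 4]];
      [:: [:: 1; 4; 3; 2]]]%N.

Definition Sigma2 : seq (seq (seq nat)) :=
  [:: [::];
      [:: [:: 1; 2; 3; 4]];
      [:: [:: 1; 3]; [:: 2; 4]];
      [:: [:: 1; 4; 3; 2]]]%N.

Definition Sigma3 : seq (seq (seq nat)) :=
  [:: [::]; [:: [:: 1; 4; 3; 2]]]%N.

Definition half : rat := 1 / 2.

Definition a1324 : fpoly (seq nat) :=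
  [:: (1, [:: t3; t4; t12]);
      (-2, [:: t34; t12]);
      (-1, [:: t2; t3; t14]);
      (-1, [:: t1; t4; t23]);
      (2, [:: t14; t23]);
      (1, [:: t1; t2; t34])].

Definition a1214 : fpoly (seq nat) :=
  [:: (1, [:: t12; t14]);
      (2, [:: t24]);
      (-1, [:: t1; t124]);
      (-1, [:: t2; t4])].

Definition a12314 : fpoly (seq nat) :=
  [:: (half, [:: t4; t1; t1; t23]);
      (half, [:: t2; t1; t1; t34]);
      (- half, [:: t1; t1; t234]);
      (half, [:: t3; t4; t1; t12]);
      (half, [:: t2; t3; t1; t14]);
      (- half, [:: t1; t14; t23]);
      (half, [:: t1; t13; t24]);
      (- half, [:: t1; t12; t34]);
      (- half, [:: t4; t1; t123]);
      (- half, [:: t3; t1; t124]);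
      (- half, [:: t2; t1; t134]);
      (-1, [:: t4; t23]);
      (1, [:: t14; t123]);
      (2, [:: t234]);
      (- half, [:: t2; t3; t4; t1; t1])].

Definition a12324 : fpoly (seq nat) :=
  [:: (-1, [:: t3; t14]);
      (1, [:: t1; t34]);
      (1, [:: t23; t124]);
      (-1, [:: t12; t234])].

Definition a12334 : fpoly (seq nat) :=
  [:: (- half, [:: t4; t3; t3; t12]);
      (- half, [:: t2; t3; t3; t14]);
      (half, [:: t3; t3; t124]);
      (- half, [:: t1; t4; t3; t23]);
      (half, [:: t3; t14; t23]);
      (- half, [:: t3; t13; t24]);
      (- half, [:: t1; t2; t3; t34]);
      (half, [:: t3; t12; t34]);
      (half, [:: t4; t3; t123]);
      (half, [:: t2; t3; t134]);
      (half, [:: t1; t3; t234]);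
      (1, [:: t4; t12]);
      (-1, [:: t34; t123]);
      (-2, [:: t124]);
      (half, [:: t1; t2; t4; t3; t3])].

Definition a123124 : fpoly (seq nat) :=
  [:: (half, [:: t3; t4; t12; t12]);
      (- half, [:: t34; t12; t12]);
      (- half, [:: t1; t2; t3; t4; t12]);
      (half, [:: t2; t3; t14; t12]);
      (half, [:: t1; t4; t23; t12]);
      (- half, [:: t14; t23; t12]);
      (half, [:: t13; t24; t12]);
      (half, [:: t1; t2; t34; t12]);
      (- half, [:: t4; t123; t12]);
      (- half, [:: t3; t124; t12]);
      (- half, [:: t2; t134; t12]);
      (- half, [:: t1; t234; t12]);
      (2, [:: t34]);
      (1, [:: t123; t124]);
      (-1, [:: t3; t4])].

Definition a123134 : fpoly (seq nat) :=
  [:: (half, [:: t24; t13; t13]);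
      (- half, [:: t1; t2; t3; t4; t13]);
      (half, [:: t3; t4; t12; t13]);
      (half, [:: t2; t3; t14; t13]);
      (half, [:: t1; t4; t23; t13]);
      (- half, [:: t14; t23; t13]);
      (half, [:: t1; t2; t34; t13]);
      (- half, [:: t12; t34; t13]);
      (- half, [:: t4; t123; t13]);
      (- half, [:: t3; t124; t13]);
      (- half, [:: t2; t134; t13]);
      (- half, [:: t1; t234; t13]);
      (-2, [:: t24]);
      (-2, [:: t23; t34]);
      (1, [:: t123; t134]);
      (2, [:: t3; t234]);
      (1, [:: t2; t4])].

Definition bivector50 : bivector (seq nat) :=
  [:: (a1324, (t13, t24))]
  ++ sum_mu Sigma1 [:: (a1214, (t12, t14))]
  ++ sum_mu Sigma2 [:: (a12314, (t123, t14)); (a12324, (t123, t24)); (a12334, (t123, t34))]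
  ++ sum_mu Sigma2 [:: (a123124, (t123, t124))]
  ++ sum_mu Sigma3 [:: (a123134, (t123, t134))].

(* Main.v *)
(* A regular function f on representations that is invariant under conjugation
   is a polynomial in traces of words, by Cayley's Omega process.  For a generic
   matrix P with rows p_1, p_2, and D large, det(P)^D f(P rho P^-1) is a
   polynomial in trace functions of rho and in the values p_a w(rho) J p_b^T,
   where w is a word and J is the symplectic form.  Omega contracts such values
   with each other, which concatenates words or closes them up into traces.  By
   invariance this polynomial is also det(P)^D f(rho), which Omega^D maps to
   D! (D + 1)! f(rho).

   The polarized Cayley-Hamilton identity expresses the trace of a product of
   four matrices through traces of products of at most three of its factors, so
   that the traces of the words of at most three letters suffice.  The product
   formula for two such words involves words of at most six letters.  The trace
   of six indeterminate letters is reduced once and for all; the algorithm draws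
   the two loops, finds the signs of their intersections, and substitutes the
   letters of each product of loops in this constant table.

   For the five-holed sphere the relations of SL(2) leave 14 generators, and the
   brackets become identities between polynomials in the entries of four
   matrices, modulo the relations a d = 1 + b c, which are checked by
   computation. *)
From Stdlib Require Import ZArith Ring_polynom BinList Zbool InitialRing.
Require Import Defs.
From mathcomp Require Import all_boot all_order all_algebra.
From mathcomp Require Import boolp reals.
From mathcomp Require Import complex ring zify.
From mathcomp Require Import mpoly.

Set Implicit Arguments.
Unset Strict Implicit.
Unset Printing Implicit Defensive.

Import Order.TTheory GRing.Theory Num.Theory.
Local Open Scope ring_scope.

(** * Two by two matrices and the Omega process *)

Lemma ord2_cases (i : 'I_2) : (i == 0) || (i == 1).
Proof. by case: i => [[|[|//]] lti]; apply/orP; [left|right]. Qed.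

Lemma matrix2P (T : Type) (A B : 'M[T]_2) :
  A 0 0 = B 0 0 -> A 0 1 = B 0 1 -> A 1 0 = B 1 0 -> A 1 1 = B 1 1 -> A = B.
Proof.
move=> h00 h01 h10 h11; apply/matrixP => i j.
by case/orP: (ord2_cases i) => /eqP->; case/orP: (ord2_cases j) => /eqP->.
Qed.

Section Mx2.
Variable F : fieldType.
Implicit Types A B : 'M[F]_2.

Definition symp : 'M[F]_2 :=
  \matrix_(i, j) (((i == 0) && (j == 1))%:R - ((i == 1) && (j == 0))%:R).

Lemma sympE : (symp 0 0 = 0) * (symp 0 1 = 1) * (symp 1 0 = -1) * (symp 1 1 = 0).
Proof. by rewrite !mxE /=; do !split; ring. Qed.

Lemma symp_sqr : symp *m symp = - 1%:M.
Proof.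
by apply: matrix2P; rewrite !mxE !big_ord_recl big_ord0 !mxE /=; ring.
Qed.

Lemma tr_symp : symp^T = - symp.
Proof. by apply: matrix2P; rewrite !mxE /=; ring. Qed.

(** The adjugate, written as in the Cayley-Hamilton theorem. It is the inverse on SL(2), and its
    entries are linear in those of [A]. *)
Definition adj2 A : 'M[F]_2 := (\tr A)%:M - A.

Lemma det2 A : \det A = A 0 0 * A 1 1 - A 0 1 * A 1 0.
Proof.
rewrite (expand_det_row _ 0) !big_ord_recl big_ord0 /cofactor !det_mx11 !mxE /=.
have -> : lift 0 0 = 1 :> 'I_2 by exact: val_inj.
have -> : lift 1 0 = 0 :> 'I_2 by exact: val_inj.
by ring.
Qed.

Lemma tr2 A : \tr A = A 0 0 + A 1 1.
Proof.
rewrite /mxtrace !big_ord_recl big_ord0 addr0; congr (_ + A _ _); exact: val_inj.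
Qed.

Lemma mul2E A B i j : (A *m B) i j = A i 0 * B 0 j + A i 1 * B 1 j.
Proof.
rewrite !mxE !big_ord_recl big_ord0 addr0; congr (_ + A _ _ * B _ _); exact: val_inj.
Qed.

Lemma adj2E A : (adj2 A 0 0 = A 1 1) * (adj2 A 0 1 = - A 0 1) *
  (adj2 A 1 0 = - A 1 0) * (adj2 A 1 1 = A 0 0).
Proof. by rewrite !mxE tr2 /=; do !split; ring. Qed.

Lemma mul_adj2 A : A *m adj2 A = (\det A)%:M.
Proof. by apply: matrix2P; rewrite mul2E !adj2E det2 !mxE /=; ring. Qed.

Lemma symp_tr A : symp *m A^T = adj2 A *m symp.
Proof. by apply: matrix2P; rewrite !mul2E !adj2E !sympE !mxE; ring. Qed.

Lemma adj2_mul A B : adj2 (A *m B) = adj2 B *m adj2 A.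
Proof.
by apply: matrix2P; rewrite !mul2E !adj2E !mul2E; ring.
Qed.

Lemma adj2K : involutive adj2.
Proof. by move=> A; apply: matrix2P; rewrite !adj2E // opprK. Qed.

Lemma invmx_adj2 A : \det A = 1 -> invmx A = adj2 A.
Proof.
move=> dA; have uA : A \in unitmx by rewrite unitmxE dA unitr1.
by apply: (can_inj (mulKmx uA)); rewrite mulmxV // mul_adj2 dA.
Qed.

(** Polarized Cayley-Hamilton for arbitrary 2 x 2 matrices. Every trace on the right has fewer than
    four factors, which makes it a reduction rule once 2 is inverted. *)
Lemma tr_four A B C D :
  2 * \tr (A *m B *m C *m D) =
    \tr A * \tr (B *m C *m D) + \tr B * \tr (A *m C *m D)
  + \tr C * \tr (A *m B *m D) + \tr D * \tr (A *m B *m C)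
  + \tr (A *m B) * \tr (C *m D) + \tr (A *m D) * \tr (B *m C)
  - \tr (A *m C) * \tr (B *m D)
  - \tr A * \tr B * \tr (C *m D) - \tr A * \tr D * \tr (B *m C)
  - \tr B * \tr C * \tr (A *m D) - \tr C * \tr D * \tr (A *m B)
  + \tr A * \tr B * \tr C * \tr D.
Proof. by rewrite !tr2 !mul2E; ring. Qed.

End Mx2.

Section Omega.
Variable F : numFieldType.
Local Notation P := {mpoly F[4]}.
Implicit Types (p q : P) (v : 'I_4 -> F) (M N : 'M[F]_2) (a b c d i j : 'I_2).

(** The four variables are the entries of a generic matrix P; entry (a, i) has number 2 a + i. *)
Definition gidx a i : 'I_4 := inord (a.*2 + i).
Definition gvar a i : P := 'X_(gidx a i).

Lemma gidx_eq a i b j : (gidx a i == gidx b j) = (a == b) && (i == j).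
Proof.
case/orP: (ord2_cases a) => /eqP->; case/orP: (ord2_cases i) => /eqP->;
case/orP: (ord2_cases b) => /eqP->; case/orP: (ord2_cases j) => /eqP->;
by rewrite -val_eqE /= !inordK.
Qed.

Definition pd a i p : P := p^`M(gidx a i).

Lemma pd_gvar a i b j : pd a i (gvar b j) = ((a == b) && (i == j))%:R.
Proof.
rewrite /pd /gvar mderivX mnm1E gidx_eq [b == a]eq_sym [j == i]eq_sym.
case: andP => [[/eqP-> /eqP->]|_]; last by rewrite scale0r.
rewrite [X in mpolyX _ X](_ : _ = 0%MM) ?mpolyX0 ?scale1r //.
by apply/mnmP => l; rewrite mnmBE mnm0E subnn.
Qed.

Lemma pdD a i p q : pd a i (p + q) = pd a i p + pd a i q.
Proof. exact: mderivD. Qed.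

Lemma pdB a i p q : pd a i (p - q) = pd a i p - pd a i q.
Proof. exact: mderivB. Qed.

Lemma pdM a i p q : pd a i (p * q) = pd a i p * q + p * pd a i q.
Proof. exact: mderivM. Qed.

Lemma pdC a i (k : F) : pd a i k%:MP = 0.
Proof. exact: mderivC. Qed.

Lemma pd0 a i : pd a i 0 = 0.
Proof. exact: mderiv0. Qed.

Lemma pd_nat a i n : pd a i n%:R = 0.
Proof. by rewrite -mpolyC_nat pdC. Qed.

(** Restricted to a line, a polynomial that vanishes at every point has infinitely many roots in
    characteristic 0, so its directional derivative vanishes too. This lets differential operators
    act on identities known only pointwise. *)
Lemma meval_pd0 a i p : (forall v, p.@[v] = 0) -> forall v, (pd a i p).@[v] = 0.
Proof.
move=> p0 v; set k := gidx a i.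
(* [line q] is the restriction of [q] to the line through [v] in the direction of the variable [k];
   its derivative at 0 is the partial derivative at [v]. *)
pose h (j : 'I_4) : {poly F} := (v j)%:P + (j == k)%:R *: 'X.
pose line (q : P) : {poly F} := mmap polyC h q.
have lineE q t : (line q).[t] = q.@[fun l => v l + (l == k)%:R * t].
  rewrite /line; elim/mpolyind: q => [|c m q _ _ IH].
    by rewrite mmap0 meval0 horner0.
  rewrite mmapD mevalD hornerD IH mmapZ mevalZ hornerM hornerC mmapX mevalX.
  congr (c * _ + _); rewrite /mmap1 horner_prod; apply: eq_bigr => l _.
  by rewrite horner_exp /h hornerD hornerC hornerZ hornerX.
have line_deriv q : ((line q)^`()).[0] = (pd a i q).@[v].
  have lineM q1 q2 : ((line q1)^`()).[0] = (pd a i q1).@[v] ->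
      ((line q2)^`()).[0] = (pd a i q2).@[v] ->
      ((line (q1 * q2))^`()).[0] = (pd a i (q1 * q2)).@[v].
    move=> h1 h2; rewrite /line rmorphM derivM pdM hornerD !hornerM mevalD !mevalM.
    rewrite -/(line q1) -/(line q2) h1 h2 !lineE; congr (_ * _ + _ * _).
      by apply: meval_eq => l; rewrite mulr0 addr0.
    by apply: meval_eq => l; rewrite mulr0 addr0.
  elim/mpolyind: q => [|c m q _ _ IH].
    by rewrite /line mmap0 deriv0 horner0 /pd mderiv0 meval0.
  rewrite /line mmapD derivD pdD hornerD mevalD IH -mul_mpolyC.
  congr (_ + _); apply: (lineM); first by rewrite /line mmapC derivC horner0 pdC meval0.
  rewrite mpolyXE_id; apply: (big_ind (fun q => ((line q)^`()).[0] = (pd a i q).@[v])) => [||l _].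
  - by rewrite /line rmorph1 derivC horner0 -mpolyC1 pdC meval0.
  - exact: lineM.
  elim: (m l) => [|e IHe]; first by rewrite expr0 /line rmorph1 derivC horner0 -mpolyC1 pdC meval0.
  rewrite exprS; apply: (lineM) => //.
  rewrite /line mmapX mmap1U /h derivD derivC derivZ derivX add0r /pd mderivX mnm1E.
  rewrite hornerZ hornerC mulr1 mevalZ; case: eqP => [->|_]; last by rewrite mul0r.
  have -> : (U_(k) - U_(k) = 0 :> 'X_{1..4})%MM.
    by apply/mnmP => l'; rewrite mnmBE mnm0E subnn.
  by rewrite mpolyX0 meval1 mulr1.
rewrite -line_deriv; suff -> : line p = 0 by rewrite deriv0 horner0.
apply/eqP; apply: contraT => nz.
(* The first [size (line p)] natural numbers are distinct roots, more than the degree allows. *)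
pose s := [seq l%:R : F | l <- iota 0 (size (line p))].
have := @max_poly_roots _ _ s nz; rewrite size_map size_iota ltnn; apply.
  by apply/allP => t _; rewrite rootE lineE p0.
by rewrite map_inj_uniq ?iota_uniq // => l1 l2 /eqP; rewrite eqr_nat => /eqP.
Qed.

(* Cayley's Omega operator, and the bilinear operator measuring its failure to
   be a derivation. *)
Definition Omega p : P := pd 0 0 (pd 1 1 p) - pd 0 1 (pd 1 0 p).
Definition Gamma p q : P :=
  pd 0 0 p * pd 1 1 q + pd 1 1 p * pd 0 0 q
  - pd 0 1 p * pd 1 0 q - pd 1 0 p * pd 0 1 q.

Lemma OmegaD p q : Omega (p + q) = Omega p + Omega q.
Proof. by rewrite /Omega !pdD; ring. Qed.

Lemma OmegaM p q : Omega (p * q) = p * Omega q + Omega p * q + Gamma p q.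
Proof. by rewrite /Omega /Gamma !(pdM, pdD); ring. Qed.

Lemma OmegaC (k : F) : Omega k%:MP = 0.
Proof. by rewrite /Omega !pdC ?pd0 subrr. Qed.

Lemma GammaC p q : Gamma p q = Gamma q p.
Proof. by rewrite /Gamma; ring. Qed.

Lemma GammaDl p q r : Gamma (p + q) r = Gamma p r + Gamma q r.
Proof. by rewrite /Gamma !pdD; ring. Qed.

Lemma GammaMl p q r : Gamma (p * q) r = p * Gamma q r + Gamma p r * q.
Proof. by rewrite /Gamma !pdM; ring. Qed.

Lemma Gamma_const (k : F) p : Gamma k%:MP p = 0.
Proof. by rewrite /Gamma !pdC; ring. Qed.

Lemma meval_Omega0 p : (forall v, p.@[v] = 0) -> forall v, (Omega p).@[v] = 0.
Proof. by move=> p0 v; rewrite mevalB !meval_pd0 ?subrr //; apply: meval_pd0. Qed.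

(** The value p_a M p_b^T, where p_0 and p_1 are the rows of the generic matrix. *)
Definition quad a M b : P :=
  \sum_i \sum_j (M i j)%:MP * gvar a i * gvar b j.

Lemma quadE a M b : quad a M b =
  (M 0 0)%:MP * gvar a 0 * gvar b 0 + (M 0 1)%:MP * gvar a 0 * gvar b 1 +
  (M 1 0)%:MP * gvar a 1 * gvar b 0 + (M 1 1)%:MP * gvar a 1 * gvar b 1.
Proof.
rewrite /quad !big_ord_recl !big_ord0.
have -> : lift 0 0 = 1 :> 'I_2 by exact: val_inj.
by ring.
Qed.

Lemma pd_quad c k a M b : pd c k (quad a M b) =
  (c == a)%:R * ((M k 0)%:MP * gvar b 0 + (M k 1)%:MP * gvar b 1)
  + (c == b)%:R * ((M 0 k)%:MP * gvar a 0 + (M 1 k)%:MP * gvar a 1).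
Proof.
rewrite quadE !(pdD, pdM, pdC, pd_gvar).
by case/orP: (ord2_cases k) => /eqP->; case: (c == a); case: (c == b) => /=; ring.
Qed.

Lemma Omega_quad a M b : Omega (quad a M b) = (symp F a b * \tr (M^T *m symp F))%:MP.
Proof.
have trE i j : M^T i j = M j i by rewrite mxE.
rewrite tr2 !mul2E !sympE !trE /Omega !pd_quad !(pdD, pdM, pdC, pd_gvar, pd_nat).
by case/orP: (ord2_cases a) => /eqP->; case/orP: (ord2_cases b) => /eqP->;
  rewrite !sympE /= !(mpolyCM, mpolyCD, mpolyCN, mpolyC1, mpolyC0); ring.
Qed.

(** One row of the first form is contracted with one row of the second through the symplectic form,
    which leaves a form in the two remaining rows. The four terms are the four choices; a transpose
    appears when the contracted row is on the wrong side. *)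
Lemma Gamma_quad a M b c N d : Gamma (quad a M b) (quad c N d) =
  (symp F a c)%:MP * quad b (M^T *m symp F *m N) d
  + (symp F a d)%:MP * quad b (M^T *m symp F *m N^T) c
  + (symp F b c)%:MP * quad a (M *m symp F *m N) d
  + (symp F b d)%:MP * quad a (M *m symp F *m N^T) c.
Proof.
rewrite /Gamma !pd_quad !quadE !mul2E !sympE.
have trE (A : 'M[F]_2) i j : A^T i j = A j i by rewrite mxE.
rewrite !trE !(mulr0, mulr1, mulrN1, add0r, addr0).
rewrite !(mpolyCM, mpolyCD, mpolyCN, mpolyC1, mpolyC0).
case/orP: (ord2_cases a) => /eqP->; case/orP: (ord2_cases b) => /eqP->;
case/orP: (ord2_cases c) => /eqP->; case/orP: (ord2_cases d) => /eqP->;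
by rewrite !sympE /= !(mpolyCN, mpolyC1, mpolyC0); ring.
Qed.

(** p_0 J p_1^T is the determinant of the generic matrix. *)
Definition gdet : P := quad 0 (symp F) 1.

(** Cayley's identity for 2 x 2 matrices. Since [Gamma gdet] is a derivation with value 2 det on
    det, it multiplies det^m by 2 m, and the failure of the Leibniz rule for [Omega] can be summed
    by induction. *)
Lemma Omega_gdetX n : Omega (gdet ^+ n.+1) = (n.+1 * n.+2)%:R * gdet ^+ n.
Proof.
have G1 : Gamma gdet gdet = 2 * gdet.
  rewrite /gdet Gamma_quad !sympE tr_symp !mulNmx !mulmxN !symp_sqr.
  rewrite !(mulNmx, mulmxN, opprK, mul1mx) !quadE !mxE /=.
  by rewrite !(mpolyCM, mpolyCB, mpolyCN, mpolyC1, mpolyC0); ring.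
have Gn m : Gamma gdet (gdet ^+ m) = (m.*2)%:R * gdet ^+ m.
  elim: m => [|m IH]; first by rewrite expr0 GammaC -mpolyC1 Gamma_const double0 mul0r.
  by rewrite exprS GammaC GammaMl ![Gamma _ gdet]GammaC IH G1 -!muln2; ring.
have O1 : Omega gdet = 2.
  rewrite /gdet Omega_quad tr_symp mulNmx symp_sqr opprK tr2 !mxE /= mpolyCM.
  by rewrite !(mpolyCN, mpolyCD, mpolyC1, mpolyC0); ring.
elim: n => [|n IH]; first by rewrite expr1 O1 expr0; ring.
by rewrite exprS OmegaM IH O1 Gn -!muln2 !natrM -!natr1 [gdet ^+ n.+1]exprS; ring.
Qed.

Lemma iter_Omega_gdetX (k : F) n :
  iter n Omega (k%:MP * gdet ^+ n) = (k * (n`! * n.+1`!)%:R)%:MP.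
Proof.
elim: n k => [|n IH] k; first by rewrite /= expr0 mulr1 !fact0 mulr1.
rewrite iterSr OmegaM OmegaC Gamma_const mul0r !addr0 Omega_gdetX.
rewrite mulrA -mpolyC_nat -mpolyCM IH; congr (_%:MP).
by rewrite !factS; ring.
Qed.

Lemma quadN a M b : quad a (- M) b = - quad a M b.
Proof. by rewrite !quadE !mxE !mpolyCN; ring. Qed.

(** On matrices of the form U J, transposition is the adjugate of U up to sign. Hence contractions
    of words yield words, with inverses in place of transposes. *)
Lemma mul_symp_tr (U : 'M[F]_2) : (U *m symp F)^T = - (adj2 U *m symp F).
Proof. by rewrite trmx_mul tr_symp mulNmx symp_tr. Qed.

Lemma Gamma_quad_symp a (U : 'M[F]_2) b c (V : 'M[F]_2) d :
  Gamma (quad a (U *m symp F) b) (quad c (V *m symp F) d) =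
    (symp F a c)%:MP * quad b (adj2 U *m V *m symp F) d
  + (- symp F a d)%:MP * quad b (adj2 U *m adj2 V *m symp F) c
  + (- symp F b c)%:MP * quad a (U *m V *m symp F) d
  + (symp F b d)%:MP * quad a (U *m adj2 V *m symp F) c.
Proof.
have mulJ (A B : 'M[F]_2) :
    (A *m symp F) *m symp F *m (B *m symp F) = - (A *m B *m symp F).
  by rewrite -(mulmxA _ (symp F) (symp F)) symp_sqr mulmxN mulmx1 mulNmx mulmxA.
rewrite Gamma_quad !mul_symp_tr !(mulNmx, mulmxN) !mulJ !opprK !quadN !mpolyCN.
by rewrite !mulrN !mulNr.
Qed.

Lemma Omega_quad_symp a (U : 'M[F]_2) b :
  Omega (quad a (U *m symp F) b) = (symp F a b * \tr (adj2 U))%:MP.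
Proof.
by rewrite Omega_quad mul_symp_tr mulNmx -mulmxA symp_sqr mulmxN mulmx1 opprK.
Qed.

Lemma meval_quad0 a M b : (quad a M b).@[fun=> 0] = 0.
Proof. by rewrite quadE !mevalD !mevalM !mevalXU; ring. Qed.

Definition gmx v : 'M[F]_2 := \matrix_(a, i) v (gidx a i).

Lemma meval_gdet v : gdet.@[v] = \det (gmx v).
Proof.
rewrite /gdet quadE det2 !mxE /= !(mevalD, mevalM, mevalC, mevalXU).
by ring.
Qed.

(** Because adj P = - J P^T J, the entries of P M adj P are combinations of the forms p_i M J p_b^T,
    with no denominator. *)
Lemma meval_quad_conj v M i j :
  ((symp F j 0)%:MP * quad i (M *m symp F) 0
   + (symp F j 1)%:MP * quad i (M *m symp F) 1).@[v] =
  (gmx v *m M *m adj2 (gmx v)) i j.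
Proof.
rewrite !quadE !(mevalD, mevalM, mevalC, mevalXU) !mul2E.
by case/orP: (ord2_cases j) => /eqP->; rewrite !adj2E !sympE !mxE; ring.
Qed.

Lemma iter_Omega_eq p q k : (forall v, p.@[v] = q.@[v]) ->
  forall v, (iter k Omega p).@[v] = (iter k Omega q).@[v].
Proof.
move=> pq v; apply/eqP; rewrite -subr_eq0 -mevalB; apply/eqP; move: v.
elim: k => [|k IH] v /=; first by rewrite mevalB pq subrr.
suff -> : Omega (iter k Omega p) - Omega (iter k Omega q) =
  Omega (iter k Omega p - iter k Omega q) by apply: meval_Omega0.
by rewrite /Omega !pdB; ring.
Qed.

End Omega.

(** * Invariants are polynomials in traces *)

Section Generated.
Variables (R : realType) (T : Type).
Local Notation C := (complex R).
Implicit Types (S : (T -> C) -> Prop) (f h : T -> C).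

Lemma gen_ext S f h : f =1 h -> generated S f -> generated S h.
Proof. by move=> /funext ->. Qed.

Lemma gen_trans S S' f :
  (forall h, S h -> generated S' h) -> generated S f -> generated S' f.
Proof.
move=> sub; elim=> {f} [f /sub //|c|f h _ Hf _ Hh|f h _ Hf _ Hh].
- exact: gen_const.
- exact: gen_add.
- exact: gen_mul.
Qed.

Lemma gen_scale S (c : C) f : generated S f -> generated S (fun x => c * f x).
Proof. by move=> Sf; apply: gen_mul => //; apply: gen_const. Qed.

Lemma gen_opp S f : generated S f -> generated S (fun x => - f x).
Proof. by move=> Sf; apply: gen_ext (gen_scale (-1) Sf) => x; rewrite mulN1r. Qed.

Lemma gen_sub S f h : generated S f -> generated S h -> generated S (fun x => f x - h x).
Proof. by move=> Sf Sh; apply: gen_add => //; apply: gen_opp. Qed.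

Lemma gen_sum S (I : Type) (r : seq I) (F : I -> T -> C) :
  (forall i, generated S (F i)) -> generated S (fun x => \sum_(i <- r) F i x).
Proof.
move=> SF; elim: r => [|i r IH].
  by apply: gen_ext (gen_const S 0) => x; rewrite big_nil.
by apply: gen_ext (gen_add (SF i) IH) => x; rewrite big_cons.
Qed.

Lemma gen_prod S (I : Type) (r : seq I) (F : I -> T -> C) :
  (forall i, generated S (F i)) -> generated S (fun x => \prod_(i <- r) F i x).
Proof.
move=> SF; elim: r => [|i r IH].
  by apply: gen_ext (gen_const S 1) => x; rewrite big_nil.
by apply: gen_ext (gen_mul (SF i) IH) => x; rewrite big_cons.
Qed.

End Generated.

(** * Matrices of words, their inverses and their conjugates *)

Section Words.
Variables (R : realType) (n g : nat).
Local Notation C := (complex R).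
Implicit Types (rho : rep R n g) (f : band n g -> 'M[C]_2) (w u v : word n g).

Definition letter_mx f (l : letter n g) : 'M[C]_2 :=
  if l.2 then f l.1 else invmx (f l.1).

Definition winv w : word n g := rev [seq (l.1, ~~ l.2) | l <- w].

Lemma word_mx_nil f : word_mx f [::] = 1%:M.
Proof. by rewrite /word_mx big_nil. Qed.

Lemma word_mx_cons f l w : word_mx f (l :: w) = letter_mx f l *m word_mx f w.
Proof. by rewrite /word_mx big_cons. Qed.

Lemma word_mx_cat f u v : word_mx f (u ++ v) = word_mx f u *m word_mx f v.
Proof.
elim: u => [|l u IH]; first by rewrite word_mx_nil mul1mx.
by rewrite cat_cons !word_mx_cons IH mulmxA.
Qed.

Lemma letter_mx_adj rho l : letter_mx rho (l.1, ~~ l.2) = adj2 (letter_mx rho l).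
Proof.
case: l => x [] /=; rewrite /letter_mx /= invmx_adj2 ?rep_det //.
by rewrite adj2K.
Qed.

Lemma det_letter_mx rho l : \det (letter_mx rho l) = 1.
Proof. by rewrite /letter_mx; case: l.2; rewrite ?det_inv rep_det ?invr1. Qed.

Lemma det_word_mx rho w : \det (word_mx rho w) = 1.
Proof.
elim: w => [|l w IH]; first by rewrite word_mx_nil det1.
by rewrite word_mx_cons det_mulmx IH det_letter_mx mulr1.
Qed.

Lemma adj2_1 : adj2 1%:M = 1%:M :> 'M[C]_2.
Proof. by apply: matrix2P; rewrite !adj2E !mxE ?oppr0. Qed.

Lemma word_mx_winv rho w : word_mx rho (winv w) = adj2 (word_mx rho w).
Proof.
elim: w => [|l w IH]; first by rewrite /winv /= word_mx_nil adj2_1.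
rewrite /winv /= rev_cons -cats1 word_mx_cat [word_mx rho (rev _)]IH.
by rewrite !word_mx_cons word_mx_nil mulmx1 adj2_mul letter_mx_adj.
Qed.

Lemma letter_mx_conj rho f (P : 'M[C]_2) l : P \in unitmx ->
  (forall x, f x = P *m rho x *m invmx P) ->
  letter_mx f l = P *m letter_mx rho l *m invmx P.
Proof.
move=> uP h; have ur x : rho x \in unitmx by rewrite unitmxE rep_det unitr1.
rewrite /letter_mx; case: l.2 => //.
have uf : f l.1 \in unitmx by rewrite h !unitmx_mul uP ur unitmx_inv uP.
apply: (can_inj (mulKmx uf)); rewrite mulmxV // h !mulmxA mulmxKV //.
by rewrite -(mulmxA P) mulmxV // mulmx1 mulmxV.
Qed.

Lemma word_mx_conj rho f (P : 'M[C]_2) w : P \in unitmx ->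
  (forall x, f x = P *m rho x *m invmx P) ->
  word_mx f w = P *m word_mx rho w *m invmx P.
Proof.
move=> uP h; elim: w => [|l w IH]; first by rewrite !word_mx_nil mulmx1 mulmxV.
by rewrite !word_mx_cons IH (letter_mx_conj _ uP h) !mulmxA mulmxKV.
Qed.

Lemma regular_letter (x : band n g) i j : regular (fun rho => rho x i j).
Proof. by apply: gen_in; exists x, i, j. Qed.

Lemma regular_letter_mx l i j : regular (fun rho => letter_mx rho l i j).
Proof.
rewrite /letter_mx; case: l => x [] /=; first exact: regular_letter.
apply: (@gen_ext _ _ _ (fun rho => adj2 (rho x) i j)).
  by move=> rho; rewrite invmx_adj2 ?rep_det.
case/orP: (ord2_cases i) => /eqP->; case/orP: (ord2_cases j) => /eqP->.
- by apply: gen_ext (regular_letter x 1 1) => rho; rewrite adj2E.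
- by apply: gen_ext (gen_opp (regular_letter x 0 1)) => rho; rewrite adj2E.
- by apply: gen_ext (gen_opp (regular_letter x 1 0)) => rho; rewrite adj2E.
- by apply: gen_ext (regular_letter x 0 0) => rho; rewrite adj2E.
Qed.

Lemma regular_word_mx w i j : regular (fun rho => word_mx rho w i j).
Proof.
elim: w i => [|l w IH] i.
  by apply: gen_ext (gen_const _ ((i == j)%:R)) => rho; rewrite word_mx_nil mxE.
apply: (@gen_ext _ _ _ (fun rho =>
  letter_mx rho l i 0 * word_mx rho w 0 j + letter_mx rho l i 1 * word_mx rho w 1 j)).
  by move=> rho; rewrite word_mx_cons mul2E.
by apply: gen_add; apply: gen_mul; first [exact: (regular_letter_mx l i) | exact: IH].
Qed.

Lemma coord_ring_tr w : coord_ring (tr w : rfun R n g).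
Proof.
split.
  apply: (@gen_ext _ _ _ (fun rho => word_mx rho w 0 0 + word_mx rho w 1 1)).
    by move=> rho; rewrite /tr tr2.
  by apply: gen_add; apply: regular_word_mx.
move=> rho rho' P dP h; rewrite /tr.
have uP : P \in unitmx by rewrite unitmxE dP unitr1.
by rewrite (word_mx_conj _ uP h) mxtrace_mulC mulmxA mulVmx // mul1mx.
Qed.

Lemma conj_rep rho (P : 'M[C]_2) : P \in unitmx ->
  exists rho' : rep R n g, forall x, rho' x = P *m rho x *m invmx P.
Proof.
move=> uP; pose f (x : band n g) := P *m rho x *m invmx P.
have df x : \det (f x) = 1.
  by rewrite !det_mulmx rep_det mulr1 -det_mulmx mulmxV ?det1.
have rf : word_mx f (relator n g) = 1%:M.
  by rewrite (@word_mx_conj rho f P) // rep_relator mulmx1 mulmxV.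
by exists (Rep df rf).
Qed.

(* Only conjugations by SL(2) are assumed to preserve f, but scalar matrices
   act trivially and every determinant is a square. *)
Lemma conj_invariant_unit (f : rfun R n g) rho rho' (P : 'M[C]_2) :
  conj_invariant f -> P \in unitmx ->
  (forall x, rho' x = P *m rho x *m invmx P) -> f rho' = f rho.
Proof.
move=> inv uP h; have dP : \det P != 0 by rewrite unitmxE unitfE in uP.
have [s s2] : exists s : C, s ^+ 2 = \det P by exists (sqrtC (\det P)); rewrite sqrtCK.
have s0 : s != 0 by apply: contraNneq dP => s0; rewrite -s2 s0 expr0n.
apply: (inv _ _ (s^-1 *: P)).
  by rewrite detZ -s2 -exprMn mulVf ?expr1n.
have us : s^-1 \is a GRing.unit by rewrite unitfE invr_eq0.
move=> x; rewrite h invmxZ ?unitmxZ // invrK.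
by rewrite -scalemxAl -scalemxAl -scalemxAr scalerA mulVf // scale1r.
Qed.

End Words.

Section FirstFundamentalTheorem.
Variables (R : realType) (n g : nat).
Local Notation C := (complex R).
Local Notation P := {mpoly C[4]}.
Implicit Types (rho : rep R n g) (w u v : word n g) (f h : rfun R n g).

Definition trace_fun : rfun R n g -> Prop :=
  generated (fun e => exists w, e = tr w).

Lemma trace_fun_tr w : trace_fun (tr w).
Proof. by apply: gen_in; exists w. Qed.

(* This algebra is stable under Omega, and its members have trace functions as
   constant terms. *)
Inductive bracket_fun : (rep R n g -> P) -> Prop :=
| br_trace f : trace_fun f -> bracket_fun (fun rho => (f rho)%:MP)
| br_quad a w b : bracket_fun (fun rho => quad a (word_mx rho w *m symp C) b)
| br_add p q : bracket_fun p -> bracket_fun q -> bracket_fun (fun rho => p rho + q rho)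
| br_mul p q : bracket_fun p -> bracket_fun q -> bracket_fun (fun rho => p rho * q rho).

Lemma br_ext p q : p =1 q -> bracket_fun p -> bracket_fun q.
Proof. by move=> /funext ->. Qed.

Lemma br_const (k : C) : bracket_fun (fun=> k%:MP).
Proof. by apply: br_trace; apply: gen_const. Qed.

Lemma br_scale (k : C) p : bracket_fun p -> bracket_fun (fun rho => k%:MP * p rho).
Proof. by move=> Bp; apply: br_mul => //; apply: br_const. Qed.

Lemma br_exp p k : bracket_fun p -> bracket_fun (fun rho => p rho ^+ k).
Proof.
move=> Bp; elim: k => [|k IH].
  by apply: br_ext (br_const 1) => rho; rewrite expr0 mpolyC1.
by apply: br_ext (br_mul Bp IH) => rho; rewrite exprS.
Qed.

Lemma br_quadZ (k : C) a w b :
  bracket_fun (fun rho => k%:MP * quad a (word_mx rho w *m symp C) b).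
Proof. by apply: br_scale; apply: br_quad. Qed.

(** [Gamma] is a derivation in each argument and kills constants, so a double induction reduces to
    two forms p_a w J p_b^T. Their contraction concatenates the words, one of them possibly
    inverted. *)
Lemma br_Gamma p q : bracket_fun p -> bracket_fun q ->
  bracket_fun (fun rho => Gamma (p rho) (q rho)).
Proof.
have swap p1 q1 : bracket_fun (fun rho => Gamma (p1 rho) (q1 rho)) ->
    bracket_fun (fun rho => Gamma (q1 rho) (p1 rho)).
  by apply: br_ext => rho; rewrite GammaC.
have const f q1 : bracket_fun (fun rho => Gamma (f rho)%:MP (q1 rho)).
  by apply: br_ext (br_const 0) => rho; rewrite Gamma_const mpolyC0.
have right p1 : (forall a w b,
      bracket_fun (fun rho => Gamma (p1 rho) (quad a (word_mx rho w *m symp C) b))) ->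
    bracket_fun q -> bracket_fun (fun rho => Gamma (p1 rho) (q rho)).
  move=> Hq; elim=> {q} [f _|a w b|q1 q2 _ H1 _ H2|q1 q2 B1 H1 B2 H2].
  - exact/swap/const.
  - exact: Hq.
  - by apply: br_ext (br_add H1 H2) => rho; rewrite -!(GammaC _ (p1 rho)) GammaDl.
  - apply: br_ext (br_add (br_mul B1 H2) (br_mul H1 B2)) => rho.
    by rewrite ![Gamma (p1 rho) _]GammaC GammaMl.
move=> Bp Bq; elim: Bp => {p} [f _|a w b|p1 p2 _ H1 _ H2|p1 p2 B1 H1 B2 H2].
- exact: const.
- apply: right => // c u d.
  apply: br_ext (br_add (br_add (br_add
    (br_quadZ (symp C a c) b (winv w ++ u) d)
    (br_quadZ (- symp C a d) b (winv w ++ winv u) c))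
    (br_quadZ (- symp C b c) a (w ++ u) d))
    (br_quadZ (symp C b d) a (w ++ winv u) c)) => rho.
  by rewrite Gamma_quad_symp !word_mx_cat !word_mx_winv.
- by apply: br_ext (br_add H1 H2) => rho; rewrite GammaDl.
- by apply: br_ext (br_add (br_mul B1 H2) (br_mul H1 B2)) => rho; rewrite GammaMl.
Qed.

Lemma br_Omega p : bracket_fun p -> bracket_fun (fun rho => Omega (p rho)).
Proof.
elim=> {p} [f _|a w b|p1 p2 _ H1 _ H2|p1 p2 B1 H1 B2 H2].
- by apply: br_ext (br_const 0) => rho; rewrite OmegaC mpolyC0.
- apply: br_ext (br_trace (gen_scale (symp C a b) (trace_fun_tr (winv w)))) => rho.
  by rewrite Omega_quad_symp -word_mx_winv.
- by apply: br_ext (br_add H1 H2) => rho; rewrite OmegaD.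
- by apply: br_ext (br_add (br_add (br_mul B1 H2) (br_mul H1 B2)) (br_Gamma B1 B2)) => rho;
    rewrite OmegaM.
Qed.

Lemma br_meval0 p : bracket_fun p -> trace_fun (fun rho => (p rho).@[fun=> 0]).
Proof.
elim=> {p} [f Hf|a w b|p1 p2 _ H1 _ H2|p1 p2 _ H1 _ H2].
- by apply: gen_ext Hf => rho; rewrite mevalC.
- by apply: gen_ext (gen_const _ 0) => rho; rewrite meval_quad0.
- by apply: gen_ext (gen_add H1 H2) => rho; rewrite mevalD.
- by apply: gen_ext (gen_mul H1 H2) => rho; rewrite mevalM.
Qed.

Lemma br_gdet : bracket_fun (fun=> gdet C).
Proof. by apply: br_ext (br_quad 0 [::] 1) => rho; rewrite word_mx_nil mul1mx. Qed.

(* p is a denominator-free form of the function P |-> f (P rho P^-1). *)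
Lemma regular_conj f : regular f -> exists (D : nat) p, bracket_fun p /\
  forall rho rho' (v : 'I_4 -> C), gmx v \in unitmx ->
    (forall x, rho' x = gmx v *m rho x *m invmx (gmx v)) ->
    (p rho).@[v] = \det (gmx v) ^+ D * f rho'.
Proof.
elim=> {f} [_ [x [i [j ->]]]|k|f1 f2 _ [D1 [p1 [B1 H1]]] _ [D2 [p2 [B2 H2]]]
           |f1 f2 _ [D1 [p1 [B1 H1]]] _ [D2 [p2 [B2 H2]]]].
(* For a matrix entry one factor det P turns P^-1 into adj P. *)
- exists 1%N, (fun rho => (symp C j 0)%:MP * quad i (word_mx rho [:: (x, true)] *m symp C) 0
    + (symp C j 1)%:MP * quad i (word_mx rho [:: (x, true)] *m symp C) 1); split.
    by apply: br_add; apply: br_quadZ.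
  move=> rho rho' v uv h; rewrite h expr1 word_mx_cons word_mx_nil mulmx1.
  rewrite /letter_mx /=; have d0 : \det (gmx v) != 0 by rewrite -unitfE -unitmxE.
  have -> : invmx (gmx v) = (\det (gmx v))^-1 *: adj2 (gmx v).
    apply: (can_inj (mulKmx uv)).
    by rewrite mulmxV // -scalemxAr mul_adj2 scale_scalar_mx mulVf.
  have -> : (gmx v *m rho x *m ((\det (gmx v))^-1 *: adj2 (gmx v))) i j =
      (\det (gmx v))^-1 * (gmx v *m rho x *m adj2 (gmx v)) i j.
    by rewrite -scalemxAr [LHS]mxE.
  rewrite mulrA divff // mul1r.
  exact: meval_quad_conj.
- exists 0%N, (fun=> k%:MP); split; first exact: br_const.
  by move=> rho rho' v _ _; rewrite mevalC expr0 mul1r.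
(* Powers of the determinant bring the two summands to a common denominator. *)
- exists (D1 + D2)%N, (fun rho => gdet C ^+ D2 * p1 rho + gdet C ^+ D1 * p2 rho).
  split; first by apply: br_add; apply: br_mul => //; apply: br_exp; apply: br_gdet.
  move=> rho rho' v uv h; rewrite mevalD !mevalM !rmorphXn /= !meval_gdet.
  by rewrite (H1 _ _ _ uv h) (H2 _ _ _ uv h) exprD; ring.
- exists (D1 + D2)%N, (fun rho => p1 rho * p2 rho); split; first exact: br_mul.
  move=> rho rho' v uv h.
  by rewrite mevalM (H1 _ _ _ uv h) (H2 _ _ _ uv h) exprD; ring.
Qed.

Lemma coord_ring_trace_fun f : coord_ring f -> trace_fun f.
Proof.
case=> /regular_conj [D [p [Bp Hp]]] inv.
(* The extra factor det P makes both sides vanish at singular matrices, where conjugation is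
   undefined; the identity thus holds at every point. *)
have Hdet rho (v : 'I_4 -> C) : (gdet C * p rho).@[v] = ((f rho)%:MP * gdet C ^+ D.+1).@[v].
  rewrite !mevalM rmorphXn /= mevalC meval_gdet.
  have [d0|dn0] := eqVneq (\det (gmx v)) 0; first by rewrite d0 exprS !mul0r mulr0.
  have uv : gmx v \in unitmx by rewrite unitmxE unitfE.
  have [rho' h] := conj_rep rho uv.
  by rewrite (Hp _ _ _ uv h) (conj_invariant_unit inv uv h) exprS; ring.
have B : bracket_fun (fun rho => iter D.+1 (@Omega C) (gdet C * p rho)).
  elim: D.+1 => [|k IH]; first by apply: br_mul => //; apply: br_gdet.
  exact: br_Omega IH.
(* After D + 1 applications of Omega the right-hand side is the constant (D + 1)! (D + 2)! f(rho);
   the left-hand side is evaluated at P = 0 and divided by this factor. *)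
have := gen_scale ((D.+1`! * D.+2`!)%:R^-1) (br_meval0 B).
apply: gen_ext => rho.
rewrite (iter_Omega_eq _ (Hdet rho)) iter_Omega_gdetX mevalC mulrC mulfK //.
by rewrite pnatr_eq0 -lt0n muln_gt0 !fact_gt0.
Qed.

End FirstFundamentalTheorem.

(** * Reduction of traces to words of at most three letters *)

Section TripleTraces.
Variable F : numFieldType.
Implicit Types (x : nat -> 'M[F]_2) (s : seq nat).

Definition triple : Type := (nat * nat * nat)%type.
(** Formal polynomials in traces of triple products. One such polynomial is valid for all matrices
    at once, so it can be written into a program as a constant. *)
Definition tpoly : Type := seq (rat * seq triple).

Definition tr3 x (t : triple) : F := \tr (x t.1.1 *m x t.1.2 *m x t.2).

Definition eval_tpoly x (p : tpoly) : F :=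
  \sum_(m <- p) ratr m.1 * \prod_(t <- m.2) tr3 x t.

Definition mx_word x s : 'M[F]_2 := \big[mulmx/1%:M]_(k <- s) x k.

(* The matrix number 0 is the identity, so that three letters also encode
   shorter words. *)
Definition texpr (f : (nat -> 'M[F]_2) -> F) : Prop :=
  exists p : tpoly, forall x, x 0%N = 1%:M -> f x = eval_tpoly x p.

Lemma texpr_ext f h : (forall x, x 0%N = 1%:M -> f x = h x) -> texpr f -> texpr h.
Proof. by move=> fh [p Hp]; exists p => x x0; rewrite -fh ?Hp. Qed.

Lemma texpr_tr3 t : texpr (fun x => tr3 x t).
Proof.
exists [:: (1, [:: t])] => x _.
by rewrite /eval_tpoly !big_seq1 rmorph1 mul1r.
Qed.

Lemma texpr_add f h : texpr f -> texpr h -> texpr (fun x => f x + h x).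
Proof.
move=> [p Hp] [q Hq]; exists (p ++ q) => x x0.
by rewrite /eval_tpoly big_cat /= Hp // Hq.
Qed.

Lemma texpr_scale (c : rat) f : texpr f -> texpr (fun x => ratr c * f x).
Proof.
move=> [p Hp]; exists [seq (c * m.1, m.2) | m <- p] => x x0.
rewrite Hp // /eval_tpoly big_map big_distrr /=.
by apply: eq_bigr => m _; rewrite rmorphM mulrA.
Qed.

Lemma texpr_sub f h : texpr f -> texpr h -> texpr (fun x => f x - h x).
Proof.
move=> Tf Th; apply: texpr_ext (texpr_add Tf (texpr_scale (-1) Th)) => x _.
by rewrite rmorphN1 mulN1r.
Qed.

Lemma texpr_mul f h : texpr f -> texpr h -> texpr (fun x => f x * h x).
Proof.
move=> [p Hp] [q Hq].
exists [seq (a.1 * b.1, a.2 ++ b.2) | a <- p, b <- q] => x x0.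
rewrite Hp // Hq // /eval_tpoly big_allpairs_dep big_distrl /=.
apply: eq_bigr => a _; rewrite big_distrr /=; apply: eq_bigr => b _.
by rewrite big_cat rmorphM /= mulrACA.
Qed.

Lemma mx_word_cons x i s : mx_word x (i :: s) = x i *m mx_word x s.
Proof. by rewrite /mx_word big_cons. Qed.

Lemma mx_word_nil x : mx_word x [::] = 1%:M.
Proof. by rewrite /mx_word big_nil. Qed.

Lemma mx_word_cat x s1 s2 : mx_word x (s1 ++ s2) = mx_word x s1 *m mx_word x s2.
Proof.
elim: s1 => [|i s1 IH]; first by rewrite mx_word_nil mul1mx.
by rewrite cat_cons !mx_word_cons IH mulmxA.
Qed.

(** Strong induction on the length. A word of at least four letters is cut into three letters and a
    nonempty rest, and the four-matrix identity leaves only traces of strictly shorter words. *)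
Lemma texpr_word s : texpr (fun x => \tr (mx_word x s)).
Proof.
have [m] := ubnP (size s); elim: m s => // m IH [|a [|b [|c [|d s]]]] /= le_m.
- apply: texpr_ext (texpr_tr3 (0, 0, 0)%N) => x x0.
  by rewrite /tr3 /= x0 !mulmx1 mx_word_nil.
- apply: texpr_ext (texpr_tr3 (a, 0, 0)%N) => x x0.
  by rewrite /tr3 /= x0 !mulmx1 mx_word_cons mx_word_nil mulmx1.
- apply: texpr_ext (texpr_tr3 (a, b, 0)%N) => x x0.
  by rewrite /tr3 /= x0 !mulmx1 !mx_word_cons mx_word_nil mulmx1.
- apply: texpr_ext (texpr_tr3 (a, b, c)%N) => x x0.
  by rewrite /tr3 /= !mx_word_cons mx_word_nil mulmx1 mulmxA.
pose D := d :: s.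
have E w : (size w < (size s).+4)%N -> texpr (fun x => \tr (mx_word x w)).
  by move=> lt; apply: IH; exact: leq_trans lt le_m.
pose e1 i := E [:: i] isT.
pose e2 i j := E [:: i; j] isT.
pose eD := E D (ltnW (ltnW (leqnn _))).
pose e1D i := E (i :: D) (ltnW (leqnn _)).
pose e2D i j := E (i :: j :: D) (leqnn _).
have eABC := E [:: a; b; c] isT.
have T := texpr_mul.
(* The summands follow the order of the right-hand side of [tr_four]. *)
have := texpr_scale 2^-1
  (texpr_add (texpr_sub (texpr_sub (texpr_sub (texpr_sub (texpr_sub
    (texpr_add (texpr_add (texpr_add (texpr_add (texpr_add
      (T _ _ (e1 a) (e2D b c)) (T _ _ (e1 b) (e2D a c)))
      (T _ _ (e1 c) (e2D a b))) (T _ _ eD eABC))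
      (T _ _ (e2 a b) (e1D c))) (T _ _ (e1D a) (e2 b c)))
    (T _ _ (e2 a c) (e1D b)))
    (T _ _ (T _ _ (e1 a) (e1 b)) (e1D c))) (T _ _ (T _ _ (e1 a) eD) (e2 b c)))
    (T _ _ (T _ _ (e1 b) (e1 c)) (e1D a))) (T _ _ (T _ _ (e1 c) eD) (e2 a b)))
    (T _ _ (T _ _ (T _ _ (e1 a) (e1 b)) (e1 c)) eD)).
apply: texpr_ext => x x0.
have := tr_four (x a) (x b) (x c) (mx_word x D).
rewrite !(mx_word_cons _ _ (_ :: _)) -/D !mx_word_cons ?mx_word_nil !mulmx1 !mulmxA => four.
by rewrite -four fmorphV rmorph_nat mulKf // pnatr_eq0.
Qed.

End TripleTraces.

Section TraceFunTriples.
Variables (R : realType) (n g : nat).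

(** The universal reduction is specialized to the letters of [w]. That no letter outside [w] occurs
    matters for the five-holed sphere, where positive words in four letters must stay such. *)
Lemma tr_short (w : seq (band n g * bool)) :
  generated (fun e => exists v : seq (band n g * bool),
    [/\ (size v <= 3)%N, {subset v <= w} & e = tr v :> rfun R n g]) (tr w).
Proof.
have [p Hp] := texpr_word (complex R) (iota 1 (size w)).
(* The matrix of the k-th letter of [w], counted from 1; it is the identity for k = 0 and past the
   end of [w]. *)
pose x (rho : rep R n g) (k : nat) : 'M[complex R]_2 :=
  word_mx rho (take 1 (drop k.-1 (if k is 0 then [::] else w))).
have xw rho : mx_word (x rho) (iota 1 (size w)) = word_mx rho w.
  suff h u v : w = u ++ v -> mx_word (x rho) (iota (size u).+1 (size v)) = word_mx rho v.
    exact: (h [::]).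
  elim: v u => [|l v IH] u wE; first by rewrite mx_word_nil word_mx_nil.
  rewrite mx_word_cons -[l :: v]cat1s word_mx_cat; congr (_ *m _).
    by rewrite /x /= wE drop_size_cat //= take0.
  by rewrite -(IH (rcons u l)) ?cat_rcons // size_rcons.
apply: (@gen_ext _ _ _ (fun rho => eval_tpoly (x rho) p)) => [rho|].
  by rewrite -Hp ?xw // /x /= word_mx_nil.
apply: gen_sum => m; apply: gen_scale; apply: gen_prod => t.
pose short k := take 1 (drop k.-1 (if k is 0 then [::] else w)).
have le1 k : (size (short k) <= 1)%N by rewrite size_take_min geq_minl.
have sub k : {subset short k <= w}.
  move=> l /mem_take/mem_drop; by case: k.
apply: gen_in; exists (short t.1.1 ++ short t.1.2 ++ short t.2); split.
- by rewrite !size_cat; have := le1 t.1.1; have := le1 t.1.2; have := le1 t.2; lia.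
- by move=> l; rewrite !mem_cat => /or3P[]; apply: sub.
- by apply: funext => rho; rewrite /tr3 /tr !word_mx_cat mulmxA.
Qed.

End TraceFunTriples.

(** * The Goldman bracket of two loops *)

Section Rotations.
Variable T : Type.
Implicit Types (u : seq T).

Definition rots u : seq (seq T) := [seq rot i.+1 u | i <- iota 0 (size u)].

(** The rotation by i + 1 ends with strand i and begins with strand i + 1, so the i-th chord can be
    read off its two ends. *)
Definition chord (en ex : T -> nat) (r : seq T) : nat * nat :=
  (last 0%N (map en r), seq.head 0%N (map ex r)).

Lemma big_rots (V : nmodType) (F : seq T -> V) u :
  \sum_(r <- rots u) F r = \sum_(i < size u) F (rot i.+1 u).
Proof.
by rewrite big_map -(big_mkord xpredT (fun i => F (rot i.+1 u))) /index_iota subn0.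
Qed.

Lemma last_rotS (d : T) u i : (i < size u)%N -> last d (rot i.+1 u) = nth d u i.
Proof.
move=> lti; rewrite /rot last_cat.
have st : size (take i.+1 u) = i.+1 by rewrite size_takel.
by rewrite -nth_last st /= (set_nth_default d) ?st // nth_take.
Qed.

Lemma head_rotS (d : T) u i : (i < size u)%N -> seq.head d (rot i.+1 u) = nth d (rot 1 u) i.
Proof.
move=> lti; rewrite -addn1 rotD ?addn1 // -nth0 {1}/rot.
by rewrite nth_cat size_drop size_rot subn_gt0 lti nth_drop addn0.
Qed.

End Rotations.

Lemma map_rots (T T' : Type) (f : T -> T') (u : seq T) : rots (map f u) = map (map f) (rots u).
Proof. by rewrite /rots size_map -map_comp; apply: eq_map => i /=; rewrite map_rot. Qed.

Lemma chord_map (T T' : Type) (f : T' -> T) en ex r :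
  chord en ex (map f r) = chord (en \o f) (ex \o f) r.
Proof. by rewrite /chord -!map_comp. Qed.

(* Points of the boundary line, and offsets, in units of 1/8. *)
Definition nleft (d : nat * nat) (x : nat) : bool :=
  if (d.1 < d.2)%N then (d.1 < x < d.2)%N else ~~ (d.2 < x < d.1)%N.

Section Strands.
Variables (n g : nat).

Definition nstrand : Type := (letter n g * nat)%type.

Definition to_strand (s : nstrand) : strand n g := (s.1, s.2%:R / 8).

Definition tail8 (s : nstrand) : nat := 8 * tail s.1.1 + s.2.
Definition head8 (s : nstrand) : nat := 8 * Defs.head s.1.1 + (8 - s.2).
Definition exit8 (s : nstrand) : nat := if s.1.2 then tail8 s else head8 s.
Definition entry8 (s : nstrand) : nat := if s.1.2 then head8 s else tail8 s.

Lemma tail_ptE s : tail_pt (to_strand s) = (tail8 s)%:R / 8.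
Proof. by rewrite /tail_pt /tail8 /=; field. Qed.

Lemma head_ptE s : (s.2 <= 8)%N -> head_pt (to_strand s) = (head8 s)%:R / 8.
Proof. by move=> le8; rewrite /head_pt /head8 natrD natrB //=; field. Qed.

Lemma exit_ptE s : (s.2 <= 8)%N -> exit_pt (to_strand s) = (exit8 s)%:R / 8.
Proof. by move=> le8; rewrite /exit_pt /exit8 tail_ptE head_ptE //=; case: ifP. Qed.

Lemma entry_ptE s : (s.2 <= 8)%N -> entry_pt (to_strand s) = (entry8 s)%:R / 8.
Proof. by move=> le8; rewrite /entry_pt /entry8 tail_ptE head_ptE //=; case: ifP. Qed.

Lemma on_leftE (a b x : nat) :
  on_left (a%:R / 8, b%:R / 8) (x%:R / 8) = nleft (a, b) x.
Proof. by rewrite /on_left /nleft /= !ltr_pM2r ?invr_gt0 // !ltr_nat. Qed.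

(** Distinct offsets suffice whatever the bands are, so letters may be repeated within a loop and
    shared by the two loops. *)
Lemma general_position_offsets (u v : seq nstrand) :
  all (fun s => 0 < s.2 < 8)%N (u ++ v) -> uniq [seq s.2 | s <- u ++ v] ->
  general_position (map to_strand u) (map to_strand v).
Proof.
move=> in8 un; rewrite /general_position -map_cat; apply/andP; split.
  rewrite all_map; apply: sub_all in8 => s /= /andP[gt0 lt8].
  by rewrite /in_band /= divr_gt0 ?ltr0n //= ltr_pdivrMr // mul1r ltr_nat.
rewrite -map_comp; apply: (@map_uniq _ _ snd); rewrite -map_comp.
have -> : map (snd \o (fun s : strand n g => (s.1.1, s.2)) \o to_strand) (u ++ v) =
    map (fun k : nat => k%:R / 8 : rat) (map snd (u ++ v)) by rewrite -map_comp.
rewrite map_inj_uniq //.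
have n8 : (8 : rat) != 0 by [].
move=> k k' /(divIf n8) /eqP.
by rewrite eqr_nat => /eqP.
Qed.

Variable R : realType.

Lemma nth_chords (u : seq nstrand) i : all (fun s => s.2 <= 8)%N u -> (i < size u)%N ->
  let d := chord entry8 exit8 (rot i.+1 u) in
  nth (0, 0) (chords (map to_strand u)) i = (d.1%:R / 8, d.2%:R / 8).
Proof.
move=> le8 lti /=.
have [s0 _] : exists s0 : nstrand, True by case: u lti {le8} => // s0; exists s0.
rewrite (nth_map (to_strand s0, to_strand s0)) ?size_zip ?size_rot ?size_map ?minnn //.
rewrite nth_zip ?size_rot // -map_rot !(nth_map s0) ?size_rot //=.
have in8 (s : seq nstrand) j :
    all (fun s => s.2 <= 8)%N s -> (j < size s)%N -> ((nth s0 s j).2 <= 8)%N.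
  by move=> /all_nthP h /h.
have rot8 : all (fun s => s.2 <= 8)%N (rot 1 u).
  by rewrite /rot all_cat andbC -all_cat cat_take_drop.
rewrite entry_ptE ?exit_ptE ?in8 ?size_rot //.
rewrite -(last_rotS s0 lti) -(head_rotS s0 lti).
have : size (rot i.+1 u) != 0%N by rewrite size_rot; case: (size u) lti.
by case: (rot i.+1 u) => //= s r _; rewrite last_map.
Qed.

Definition nsign (o : bool) (d d' : nat * nat) : int :=
  (if o then 1 else -1) * ((nleft d d'.2)%:Z - (nleft d d'.1)%:Z).

(** A rotation determines both a chord and the loop based on it, so the double sum over chords
    becomes a sum over pairs of rotations. *)
Lemma goldman_sum_rots (o : bool) (u v : seq nstrand) (rho : rep R n g) :
  all (fun s => s.2 <= 8)%N u -> all (fun s => s.2 <= 8)%N v ->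
  goldman_sum o (map to_strand u) (map to_strand v) rho =
  \sum_(r <- rots u) \sum_(r' <- rots v)
    (nsign o (chord entry8 exit8 r) (chord entry8 exit8 r'))%:~R
    * (tr (map fst (r ++ r')) rho - 2^-1 * tr (map fst u) rho * tr (map fst v) rho).
Proof.
move=> u8 v8; rewrite /goldman_sum !size_map big_rots; apply: eq_bigr => i _.
rewrite big_rots; apply: eq_bigr => j _.
rewrite !nth_chords // /chord_sign /nsign !on_leftE.
have wE w : loop_word (map to_strand w) = map fst w by rewrite /loop_word -map_comp.
by rewrite -!map_rot !wE (map_cat fst (rot _ u)) -!surjective_pairing.
Qed.

End Strands.

Local Close Scope ring_scope.

(** * Computable functions on encoded data *)

Class Enc (A : Type) := enc : A -> tree.
#[export] Instance Enc_tree : Enc tree := id.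
#[export] Instance Enc_nat : Enc nat := enc_nat.
#[export] Instance Enc_bool : Enc bool := enc_bool.
#[export] Instance Enc_rat : Enc rat := enc_rat.
#[export] Instance Enc_pair A B (eA : Enc A) (eB : Enc B) : Enc (A * B) := enc_pair eA eB.
#[export] Instance Enc_seq A (eA : Enc A) : Enc (seq A) := enc_seq eA.

(** The closure lemmas concern functions of a common environment [G], so that an expression is shown
    computable by following its syntax. *)
Definition computable (A B : Type) (eA : Enc A) (eB : Enc B) (f : A -> B) : Prop :=
  exists p, forall a, run p (enc a) (enc (f a)).
Arguments computable {A B eA eB} f.

Section Computable.
Context {G : Type} {eG : Enc G}.

Lemma computable_id : computable (fun x : G => x).
Proof. by exists PId => a; apply: run_id. Qed.

Lemma run_const (t : tree) : exists p, forall x, run p x t.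
Proof.
elim: t => [|l [p Hp] r [q Hq]]; first by exists PLeaf => y; apply: run_leaf.
by exists (PNode p q) => y; apply: run_node.
Qed.

Lemma computable_const A {eA : Enc A} (c : A) : computable (fun _ : G => c).
Proof. by have [p Hp] := run_const (enc c); exists p. Qed.

Lemma computable_app A B (eA : Enc A) (eB : Enc B) (h : A -> B) (f : G -> A) :
  computable h -> computable f -> computable (fun x => h (f x)).
Proof. by move=> [p Hp] [q Hq]; exists (PSeq q p) => a; apply: run_seq (Hq a) (Hp _). Qed.

Lemma computable_pair A B (eA : Enc A) (eB : Enc B) (f : G -> A) (h : G -> B) :
  computable f -> computable h -> computable (fun x => (f x, h x)).
Proof. by move=> [p Hp] [q Hq]; exists (PNode p q) => a; apply: run_node. Qed.

Lemma computable_Node (f h : G -> tree) :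
  computable f -> computable h -> computable (fun x => Node (f x) (h x)).
Proof. by move=> [p Hp] [q Hq]; exists (PNode p q) => a; apply: run_node. Qed.

Lemma computable_fst A B (eA : Enc A) (eB : Enc B) (f : G -> A * B) :
  computable f -> computable (fun x => (f x).1).
Proof. by move=> [p Hp]; exists (PSeq p PLeft) => a; apply: run_seq (Hp a) (run_left _ _). Qed.

Lemma computable_snd A B (eA : Enc A) (eB : Enc B) (f : G -> A * B) :
  computable f -> computable (fun x => (f x).2).
Proof. by move=> [p Hp]; exists (PSeq p PRight) => a; apply: run_seq (Hp a) (run_right _ _). Qed.

Lemma computable_cons A (eA : Enc A) (f : G -> A) (s : G -> seq A) :
  computable f -> computable s -> computable (fun x => f x :: s x).
Proof. by move=> [p Hp] [q Hq]; exists (PNode p q) => a; apply: run_node. Qed.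

Lemma computable_if A (eA : Enc A) (b : G -> bool) (f h : G -> A) :
  computable b -> computable f -> computable h -> computable (fun x => if b x then f x else h x).
Proof.
move=> [p Hp] [q Hq] [r Hr]; exists (PIf p q r) => a; have := Hp a.
by case: (b a) => [Hb|Hb]; [apply: run_if_node Hb (Hq a) | apply: run_if_leaf Hb (Hr a)].
Qed.

Lemma computable_tree (f : G -> nat) : computable f -> computable (fun x => enc_nat (f x)).
Proof. by move=> [p Hp]; exists p. Qed.

Lemma computable_S (f : G -> nat) : computable f -> computable (fun x => (f x).+1).
Proof.
by move=> [p Hp]; exists (PNode PLeaf p) => a; apply: run_node (Hp a); apply: run_leaf.
Qed.

Lemma computable_pred (f : G -> nat) : computable f -> computable (fun x => (f x).-1).
Proof.
move=> [p Hp]; exists (PSeq p PRight) => a; apply: run_seq (Hp a) _.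
by case: (f a) => [|k]; [apply: run_right0 | apply: run_right].
Qed.

Lemma computable_eq0 (f : G -> nat) : computable f -> computable (fun x => f x == 0).
Proof.
move=> [p Hp].
have [q0 H0] := run_const (enc false); have [q1 H1] := run_const (enc true).
exists (PIf p q0 q1) => a; have := Hp a.
case: (f a) => [|k] H; first exact: run_if_leaf H (H1 _).
exact: run_if_node H (H0 _).
Qed.

Lemma computable_behead A (eA : Enc A) (s : G -> seq A) :
  computable s -> computable (fun x => behead (s x)).
Proof.
move=> [p Hp]; exists (PSeq p PRight) => a; apply: run_seq (Hp a) _.
by case: (s a) => [|y t]; [apply: run_right0 | apply: run_right].
Qed.

Lemma computable_head A (eA : Enc A) (d : G -> A) (s : G -> seq A) :
  computable d -> computable s -> computable (fun x => seq.head (d x) (s x)).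
Proof.
move=> [q Hq] [p Hp]; exists (PIf p (PSeq p PLeft) q) => a.
have := Hp a; case Es : (s a) => [|y t] H; first exact: run_if_leaf H (Hq _).
apply: run_if_node H _; apply: run_seq (Hp a) _; rewrite Es.
exact: run_left.
Qed.

(** The only construction that uses [PWhile]; all other iterations are expressed as left folds. *)
Lemma computable_foldl A B (eA : Enc A) (eB : Enc B) (step : G -> B -> A -> B)
    (init : G -> B) (s : G -> seq A) :
  computable init -> computable s -> computable (fun e : G * B * A => step e.1.1 e.1.2 e.2) ->
  computable (fun x => foldl (step x) (init x) (s x)).
Proof.
move=> [pi Hi] [ps Hs] [p Hp].
(* The state of the loop is ((x, accumulator), remaining list). *)
pose body := PNode (PNode (PSeq PLeft PLeft)
  (PSeq (PNode PLeft (PSeq PRight PLeft)) p)) (PSeq PRight PRight).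
pose loop := PWhile PRight body.
have Hloop x acc l : run loop (Node (Node (enc x) (enc acc)) (enc l))
    (Node (Node (enc x) (enc (foldl (step x) acc l))) Leaf).
  elim: l acc => [|y l IH] acc /=.
    by apply: run_while_stop; apply: run_right.
  apply: run_while_step (IH (step x acc y)); first exact: run_right.
  apply: run_node; first apply: run_node.
  - by apply: run_seq; apply: run_left.
  - apply: run_seq (Hp (x, acc, y)); apply: run_node; first exact: run_left.
    by apply: run_seq; [apply: run_right | apply: run_left].
  - by apply: run_seq; apply: run_right.
exists (PSeq (PSeq (PNode (PNode PId pi) ps) loop) (PSeq PLeft PRight)) => x.
apply: run_seq (run_seq _ (Hloop x (init x) (s x))) _; last first.
  by apply: run_seq (run_left _ _) (run_right _ _).
by apply: run_node => //; apply: run_node => //; apply: run_id.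
Qed.

Lemma computable_ext A (eA : Enc A) (f h : G -> A) : f =1 h -> computable f -> computable h.
Proof. by move=> fh [p Hp]; exists p => a; rewrite -fh. Qed.

End Computable.

Section ComputableIter.
Context {G : Type} {eG : Enc G}.

#[local] Instance Enc_unit : Enc unit := fun=> Leaf.

(** The unary number k has the same tree as a list of k units, so iteration is a fold over that
    list. *)
Lemma computable_iter B (eB : Enc B) (step : G -> B -> B) (k : G -> nat) (init : G -> B) :
  computable k -> computable (fun e : G * B => step e.1 e.2) -> computable init ->
  computable (fun x => iter (k x) (step x) (init x)).
Proof.
move=> [pk Hk] [p Hp] Hi.
have encE m : enc (nseq m tt) = enc_nat m by elim: m => //= m <-.
have units : computable (fun x => nseq (k x) tt).
  by exists pk => x; rewrite encE; apply: Hk.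
apply: computable_ext (computable_foldl (step := fun x b _ => step x b) Hi units _) => [x|].
  by elim: (k x) (init x) => //= m IH b; rewrite IH -iterSr.
apply: (computable_app (h := fun e : G * B => step e.1 e.2)); first by exists p.
exact/computable_fst/computable_id.
Qed.

Lemma computable_rev A (eA : Enc A) (s : G -> seq A) :
  computable s -> computable (fun x => rev (s x)).
Proof.
move=> Cs; apply: computable_ext (computable_foldl
    (step := fun (_ : G) (acc : seq A) (y : A) => y :: acc)
    (computable_const [::]) Cs _) => [x|].
  by rewrite -[RHS]cats0 -catrevE; elim: (s x) [::] => //= y l IH acc; rewrite IH.
by apply: computable_cons; [apply/computable_snd/computable_id
  | apply/computable_snd/computable_fst/computable_id].
Qed.

Lemma computable_cat A (eA : Enc A) (s t : G -> seq A) :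
  computable s -> computable t -> computable (fun x => s x ++ t x).
Proof.
move=> Cs Ct; apply: computable_ext (computable_foldl
    (step := fun (_ : G) (acc : seq A) (y : A) => y :: acc)
    Ct (computable_rev Cs) _) => [x|].
  by rewrite -[s x in RHS]revK -catrevE; elim: (rev _) (t x) => //= y l IH acc; rewrite IH.
by apply: computable_cons; [apply/computable_snd/computable_id
  | apply/computable_snd/computable_fst/computable_id].
Qed.

Lemma computable_rcons A (eA : Enc A) (s : G -> seq A) (y : G -> A) :
  computable s -> computable y -> computable (fun x => rcons (s x) (y x)).
Proof.
move=> Cs Cy; apply: (computable_ext (f := fun x => s x ++ [:: y x])) => [x|].
  by rewrite cats1.
by apply: computable_cat => //; apply: computable_cons => //; apply: computable_const.
Qed.

End ComputableIter.

Lemma computable_comp G A B (eG : Enc G) (eA : Enc A) (eB : Enc B) (h : A -> B) (f : G -> A) :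
  computable h -> computable f -> computable (h \o f).
Proof. exact: computable_app. Qed.

Section ComputableSeq.
Context {G : Type} {eG : Enc G}.

Lemma computable_map A B (eA : Enc A) (eB : Enc B) (h : G -> A -> B) (s : G -> seq A) :
  computable s -> computable (fun e : G * A => h e.1 e.2) ->
  computable (fun x => [seq h x y | y <- s x]).
Proof.
move=> Cs Ch; apply: computable_ext (computable_foldl
    (step := fun (x : G) (acc : seq B) (y : A) => rcons acc (h x y))
    (computable_const [::]) Cs _) => [x|].
  rewrite -[RHS]cat0s; elim: (s x) [::] => /= [|y l IH] acc; first by rewrite cats0.
  by rewrite IH cat_rcons.
apply: computable_rcons; first exact/computable_snd/computable_fst/computable_id.
apply: (computable_app (h := fun e : G * A => h e.1 e.2)
  (f := fun e : G * seq B * A => (e.1.1, e.2))) => //.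
by apply: computable_pair; [apply/computable_fst/computable_fst/computable_id
  | apply/computable_snd/computable_id].
Qed.

Lemma computable_flatten A (eA : Enc A) (s : G -> seq (seq A)) :
  computable s -> computable (fun x => flatten (s x)).
Proof.
move=> Cs; apply: computable_ext (computable_foldl
    (step := fun (_ : G) (acc y : seq A) => acc ++ y)
    (computable_const [::]) Cs _) => [x|].
  rewrite -[RHS]cat0s; elim: (s x) [::] => /= [|y l IH] acc; first by rewrite cats0.
  by rewrite IH catA.
by apply: computable_cat; [apply/computable_snd/computable_fst/computable_id
  | apply/computable_snd/computable_id].
Qed.

Lemma computable_size A (eA : Enc A) (s : G -> seq A) :
  computable s -> computable (fun x => size (s x)).
Proof.
move=> Cs; apply: computable_ext (computable_foldl
    (step := fun (_ : G) (acc : nat) (_ : A) => acc.+1)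
    (computable_const 0) Cs _) => [x|].
  by rewrite -[RHS]addn0; elim: (s x) 0 => //= y l IH acc; rewrite IH addnS.
exact/computable_S/computable_snd/computable_fst/computable_id.
Qed.

Lemma computable_addn (f h : G -> nat) :
  computable f -> computable h -> computable (fun x => f x + h x).
Proof.
move=> Cf Ch; apply: computable_ext (computable_iter (step := fun _ : G => S) Cf _ Ch) => [x|].
  by elim: (f x) => //= m ->.
exact/computable_S/computable_snd/computable_id.
Qed.

End ComputableSeq.

Section ComputableNat.
Context {G : Type} {eG : Enc G}.

Lemma computable_muln (f h : G -> nat) :
  computable f -> computable h -> computable (fun x => f x * h x).
Proof.
move=> Cf Ch; apply: computable_ext (computable_iter
    (step := fun x => addn (h x)) Cf _ (computable_const 0)) => [x|].
  by elim: (f x) => //= m ->.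
by apply: computable_addn; [apply: computable_comp Ch (computable_fst (computable_id))
  | apply/computable_snd/computable_id].
Qed.

Lemma computable_leq (f h : G -> nat) :
  computable f -> computable h -> computable (fun x => f x <= h x).
Proof.
move=> Cf Ch; rewrite /leq; apply: computable_eq0.
apply: computable_ext (computable_iter (step := fun _ : G => predn) Ch _ Cf) => [x|].
  by rewrite iter_predn.
exact/computable_pred/computable_snd/computable_id.
Qed.

Lemma computable_iota (f h : G -> nat) :
  computable f -> computable h -> computable (fun x => iota (f x) (h x)).
Proof.
move=> Cf Ch.
apply: computable_ext (computable_iter
    (step := fun (x : G) (s : seq nat) => rcons s (f x + size s))
    Ch _ (computable_const [::])) => [x|].
  elim: (h x) => // m IH; rewrite iterS IH size_iota -cats1.
  by rewrite -[in RHS]addn1 iotaD.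
apply: computable_rcons; first exact/computable_snd/computable_id.
apply: computable_addn; first by apply: computable_comp Cf (computable_fst (computable_id)).
exact/computable_size/computable_snd/computable_id.
Qed.

Lemma computable_last A (eA : Enc A) (d : G -> A) (s : G -> seq A) :
  computable d -> computable s -> computable (fun x => last (d x) (s x)).
Proof.
move=> Cd Cs; apply: computable_ext (computable_head Cd (computable_rev Cs)) => x.
by case: (lastP (s x)) => // t y; rewrite rev_rcons last_rcons.
Qed.

Lemma computable_negb (b : G -> bool) : computable b -> computable (fun x => ~~ b x).
Proof.
move=> Cb.
apply: computable_ext (computable_if Cb (computable_const false) (computable_const true)) => x.
by case: (b x).
Qed.

Lemma computable_andb (b c : G -> bool) :
  computable b -> computable c -> computable (fun x => b x && c x).
Proof.
move=> Cb Cc; apply: computable_ext (computable_if Cb Cc (computable_const false)) => x.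
by case: (b x).
Qed.

Lemma computable_drop A (eA : Enc A) (k : G -> nat) (s : G -> seq A) :
  computable k -> computable s -> computable (fun x => drop (k x) (s x)).
Proof.
move=> Ck Cs.
apply: computable_ext (computable_iter (step := fun _ : G => @behead A) Ck _ Cs) => [x|].
  by elim: (k x) => [|m IH]; rewrite ?drop0 // iterS IH -drop1 drop_drop add1n.
exact/computable_behead/computable_snd/computable_id.
Qed.

Lemma computable_nth A (eA : Enc A) (d : G -> A) (s : G -> seq A) (k : G -> nat) :
  computable d -> computable s -> computable k -> computable (fun x => nth (d x) (s x) (k x)).
Proof.
move=> Cd Cs Ck; apply: computable_ext (computable_head Cd (computable_drop Ck Cs)) => x.
by rewrite -nth0 nth_drop addn0.
Qed.

Lemma computable_rot A (eA : Enc A) (k : G -> nat) (s : G -> seq A) :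
  computable k -> computable s -> computable (fun x => rot (k x) (s x)).
Proof.
move=> Ck Cs; apply: computable_cat; first exact: computable_drop.
(* The first k elements are obtained by dropping [size - k] elements of the reversed list; the
   difference is an iterated predecessor. *)
apply: computable_ext (computable_rev (computable_drop (computable_ext (fun x => iter_predn _ _)
  (computable_iter (step := fun _ : G => predn) Ck _ (computable_size Cs)))
  (computable_rev Cs))) => [x|].
  by rewrite -rev_take ?revK // ?leq_subr // subKn.
exact/computable_pred/computable_snd/computable_id.
Qed.

End ComputableNat.

(** * The algorithm *)

(* A letter is encoded by (its tree, (its direction, (8 tail, 8 head))).  A code
   is the index of a letter together with its encoding, or (0, [::]) for the
   blank. *)
Definition pletter : Type := (tree * (bool * (nat * nat)))%type.
Definition code : Type := (nat * seq pletter)%type.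
Definition code3 : Type := (code * code * code)%type.
(* A strand is (its index, (its exit point, its entry point)). *)
Definition pstrand : Type := (nat * (nat * nat))%type.

Definition pbands (n g : nat) : seq (tree * (nat * nat)) :=
  [seq (Node (enc_nat 0) (enc_nat i), (8 * (4 * i), 8 * (4 * i + 2))) | i <- iota 0 g]
  ++ [seq (Node (enc_nat 1) (enc_nat i), (8 * (4 * i + 3), 8 * (4 * i + 1))) | i <- iota 0 g]
  ++ [seq (Node (enc_nat 2) (enc_nat j), (8 * (4 * g + 2 * j), 8 * (4 * g + 2 * j + 1)))
     | j <- iota 0 n].

Definition pletters (n g : nat) : seq pletter :=
  flatten [seq [:: (x.1, (true, x.2)); (x.1, (false, x.2))] | x <- pbands n g].

Definition number_codes (ls : seq pletter) : seq code :=
  (0, [::]) :: [seq (i.+1, [:: nth (Leaf, (true, (0, 0))) ls i]) | i <- iota 0 (size ls)].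

(** Here [k'] stands for 8 - k, the offset at the head. A blank code yields no strand. *)
Definition pstr (c : code) (k k' : nat) : seq pstrand :=
  [seq (c.1, if l.2.1 then (l.2.2.1 + k, l.2.2.2 + k') else (l.2.2.2 + k', l.2.2.1 + k))
  | l <- c.2].

(** The offsets 1, 2, 3 here and 4, 5, 6 in [ploopV] put any two such loops in general position. *)
Definition ploopU (T : code3) := pstr T.1.1 1 7 ++ pstr T.1.2 2 6 ++ pstr T.2 3 5.
Definition ploopV (T : code3) := pstr T.1.1 4 4 ++ pstr T.1.2 5 3 ++ pstr T.2 6 2.

Definition pchord (r : seq pstrand) : nat * nat :=
  (last 0 [seq s.2.2 | s <- r], seq.head 0 [seq s.2.1 | s <- r]).

(** The position of a triple in the lexicographic enumeration of triples of numbers below K. *)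
Definition index3 (K : nat) (t : triple) : nat := (t.1.1 * K + t.1.2) * K + t.2.

Definition psubst (K : nat) (env : seq nat) (p : tpoly) : fpoly nat :=
  [seq (m.1, [seq index3 K (nth 0 env t.1.1, nth 0 env t.1.2, nth 0 env t.2) | t <- m.2])
  | m <- p].

(** The values of the indeterminates of the table: 0 is the blank, 1 to 6 are the letters of the two
    words, and the product of loops starts at 7. A product with fewer than six letters is completed
    by the default 0, again the blank. *)
Definition penv (T1 T2 : code3) (r r' : seq pstrand) : seq nat :=
  [:: 0; T1.1.1.1; T1.1.2.1; T1.2.1; T2.1.1.1; T2.1.2.1; T2.2.1]
  ++ [seq s.1 | s <- r ++ r'].

(** [tabp] serves the intersections of sign +1 for the plane and [tabm] those of sign -1.
    Orientation and rational factors are contained in the tables, so the program does no rational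
    arithmetic. *)
Definition pbracket (tabp tabm : tpoly) (K : nat) (T1 T2 : code3) : fpoly nat :=
  flatten [seq flatten [seq
    if nleft (pchord r) (pchord r').2 then
      if nleft (pchord r) (pchord r').1 then [::] else psubst K (penv T1 T2 r r') tabp
    else
      if nleft (pchord r) (pchord r').1 then psubst K (penv T1 T2 r r') tabm else [::]
    | r' <- rots (ploopV T2)] | r <- rots (ploopU T1)].

Definition code_word (T : code3) : seq (tree * bool) :=
  [seq (l.1, l.2.1) | l <- T.1.1.2 ++ T.1.2.2 ++ T.2.2].

Definition ptriples (cs : seq code) : seq code3 :=
  [seq (p, c) | p <- [seq (a, b) | a <- cs, b <- cs], c <- cs].

Definition pindex (K : nat) (T : code3) : nat := index3 K (T.1.1.1, T.1.2.1, T.2.1).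

(** The generators are the traces of all words of at most three letters, with repetitions caused by
    blanks; every ordered pair of them contributes a term. *)
Definition poutput (tabp tabm : tpoly) (cs : seq code) :
    seq (seq (tree * bool)) * seq (fpoly nat * (nat * nat)) :=
  ([seq code_word T | T <- ptriples cs],
   [seq (pbracket tabp tabm (size cs) T1 T2, (pindex (size cs) T1, pindex (size cs) T2))
   | T1 <- ptriples cs, T2 <- ptriples cs]).

Ltac computable_step :=
  cbv beta;
  lazymatch goal with
  | |- computable (fun x => x) => exact: computable_id
  | |- computable fst => exact: (computable_fst computable_id)
  | |- computable snd => exact: (computable_snd computable_id)
  | |- computable (fun _ => ?c) => exact: (computable_const c)
  | |- computable (fun x => fst (@?f x)) => apply: (computable_fst (f := f))
  | |- computable (fun x => snd (@?f x)) => apply: (computable_snd (f := f))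
  | |- computable (fun x => (@?f x, @?h x)) => apply: (computable_pair (f := f) (h := h))
  | |- computable (fun x => Node (@?f x) (@?h x)) => apply: (computable_Node (f := f) (h := h))
  | |- computable (fun x => enc_nat (@?f x)) => apply: (computable_tree (f := f))
  | |- computable (fun x => (@?f x) :: (@?h x)) => apply: (computable_cons (f := f) (s := h))
  | |- computable (fun x => (@?f x) ++ (@?h x)) => apply: (computable_cat (s := f) (t := h))
  | |- computable (fun x => flatten (@?f x)) => apply: (computable_flatten (s := f))
  | |- computable (fun x => map (@?h x) (@?s x)) => apply: (computable_map (h := h) (s := s))
  | |- computable (fun x => size (@?s x)) => apply: (computable_size (s := s))
  | |- computable (fun x => iota (@?f x) (@?h x)) => apply: (computable_iota (f := f) (h := h))
  | |- computable (fun x => nth (@?d x) (@?s x) (@?k x)) =>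
      apply: (computable_nth (d := d) (s := s) (k := k))
  | |- computable (fun x => last (@?d x) (@?s x)) => apply: (computable_last (d := d) (s := s))
  | |- computable (fun x => seq.head (@?d x) (@?s x)) => apply: (computable_head (d := d) (s := s))
  | |- computable (fun x => rot (@?k x) (@?s x)) => apply: (computable_rot (k := k) (s := s))
  | |- computable (fun x => leq (@?f x) (@?h x)) => apply: (computable_leq (f := f) (h := h))
  | |- computable (fun x => addn (@?f x) (@?h x)) => apply: (computable_addn (f := f) (h := h))
  | |- computable (fun x => muln (@?f x) (@?h x)) => apply: (computable_muln (f := f) (h := h))
  | |- computable (fun x => S (@?f x)) => apply: (computable_S (f := f))
  | |- computable (fun x => andb (@?f x) (@?h x)) => apply: (computable_andb (b := f) (c := h))
  | |- computable (fun x => negb (@?f x)) => apply: (computable_negb (b := f))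
  | |- computable (fun x => if _ then _ else _) => apply: computable_if
  end.
Ltac computable_auto := repeat computable_step.

Lemma computable_number_codes G (eG : Enc G) (n g : G -> nat) : computable n -> computable g ->
  computable (fun x => number_codes (pletters (n x) (g x))).
Proof.
move=> Cn Cg.
have Cletters : computable (fun e : nat * nat => pletters e.1 e.2).
  by rewrite /pletters /pbands; computable_auto.
have Cnumber : computable number_codes by rewrite /number_codes; computable_auto.
apply: (computable_app Cnumber).
exact: (computable_app Cletters (computable_pair Cn Cg)).
Qed.

Section ComputableOutput.
Context {G : Type} {eG : Enc G}.
Implicit Types (T : G -> code3) (r : G -> seq pstrand).

Lemma computable_ploopU T : computable T -> computable (fun x => ploopU (T x)).
Proof. by move=> CT; apply: computable_app CT; rewrite /ploopU /pstr; computable_auto. Qed.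

Lemma computable_ploopV T : computable T -> computable (fun x => ploopV (T x)).
Proof. by move=> CT; apply: computable_app CT; rewrite /ploopV /pstr; computable_auto. Qed.

Lemma computable_rots A (eA : Enc A) (s : G -> seq A) :
  computable s -> computable (fun x => rots (s x)).
Proof. by move=> Cs; apply: computable_app Cs; rewrite /rots; computable_auto. Qed.

Lemma computable_pchord r : computable r -> computable (fun x => pchord (r x)).
Proof. by move=> Cr; apply: computable_app Cr; rewrite /pchord; computable_auto. Qed.

Lemma computable_nleft (d : G -> nat * nat) (k : G -> nat) :
  computable d -> computable k -> computable (fun x => nleft (d x) (k x)).
Proof.
move=> Cd Ck; apply: (computable_app (h := fun e => nleft e.1 e.2)) (computable_pair Cd Ck).
by rewrite /nleft; computable_auto.
Qed.

Lemma computable_psubst (K : G -> nat) (env : G -> seq nat) (p : tpoly) :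
  computable K -> computable env -> computable (fun x => psubst (K x) (env x) p).
Proof.
move=> CK Ce; apply: (computable_app (h := fun e => psubst e.1 e.2 p)) (computable_pair CK Ce).
by rewrite /psubst /index3; computable_auto.
Qed.

End ComputableOutput.

Ltac computable_auto2 := repeat (cbv beta;
  lazymatch goal with
  | |- computable (fun x => ploopU _) => apply: computable_ploopU
  | |- computable (fun x => ploopV _) => apply: computable_ploopV
  | |- computable (fun x => rots _) => apply: computable_rots
  | |- computable (fun x => pchord _) => apply: computable_pchord
  | |- computable (fun x => nleft _ _) => apply: computable_nleft
  | |- computable (fun x => psubst _ _ ?p) => apply: computable_psubst
  | _ => computable_step
  end).

Lemma computable_poutput tabp tabm : computable (poutput tabp tabm).
Proof.
by rewrite /poutput /ptriples /pbracket /penv /pindex /index3 /code_word; computable_auto2.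
Qed.

Local Open Scope ring_scope.

Lemma nth_allpairs (A B E : Type) (f : A -> B -> E) s t d da db i j :
  (i < size s)%N -> (j < size t)%N ->
  nth d [seq f a b | a <- s, b <- t] (i * size t + j) = f (nth da s i) (nth db t j).
Proof.
elim: s i => [|a s IH] [|i] //= lti ltj; rewrite nth_cat size_map.
  by rewrite ltj (nth_map db).
by rewrite mulSn -addnA ltnNge leq_addr /= addKn IH.
Qed.

Lemma allpairs_map2 (A A' B B' E : Type) (f : A' -> B' -> E) (h : A -> A') (k : B -> B') s t :
  [seq f a b | a <- map h s, b <- map k t] = [seq f (h a) (k b) | a <- s, b <- t].
Proof. by elim: s => //= a s ->; rewrite -map_comp. Qed.

(** * The letters of the presentation and their numbering by the program *)

Section Letters.
Variables (n g : nat).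
Local Notation lettr := (band n g * bool)%type.

Definition bands : seq (band n g) :=
  [seq band_a n i | i <- enum 'I_g] ++ [seq band_b n i | i <- enum 'I_g]
  ++ [seq band_c g j | j <- enum 'I_n].

Definition letters : seq lettr := [seq (x, b) | x <- bands, b <- [:: true; false]].

(* None is the blank letter. *)
Definition oletters : seq (option lettr) := None :: [seq Some l | l <- letters].

Definition oindex (ol : option lettr) : nat := index ol oletters.

Definition letter_code (l : lettr) : pletter :=
  (enc_band l.1, (l.2, (8 * tail l.1, 8 * Defs.head l.1)%N)).

Definition ocode (ol : option lettr) : code :=
  (oindex ol, if ol is Some l then [:: letter_code l] else [::]).

Lemma mem_bands x : x \in bands.
Proof.
rewrite !mem_cat; case: x => [[i|i]|j].
- by rewrite (_ : inl _ = band_a n i) // map_f ?mem_enum.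
- by rewrite (_ : inl _ = band_b n i) // map_f ?mem_enum ?orbT.
- by rewrite (_ : inr _ = band_c g j) // map_f ?mem_enum ?orbT.
Qed.

Lemma uniq_bands : uniq bands.
Proof.
have inj_uniq m (f : 'I_m -> band n g) : injective f -> uniq [seq f i | i <- enum 'I_m].
  by move=> injf; rewrite (map_inj_uniq injf) enum_uniq.
rewrite !cat_uniq has_cat negb_or !inj_uniq => [|i j []|i j []|i j []] //=.
rewrite andbT; apply/andP; split; last by apply/hasPn => _ /mapP[i _ ->]; apply/mapP => -[].
by apply/andP; split; apply/hasPn => _ /mapP[i _ ->]; apply/mapP => -[].
Qed.

Lemma mem_oletters ol : ol \in oletters.
Proof.
case: ol => [[x b]|]; last by rewrite mem_head.
rewrite inE /= map_f //; apply/allpairsP; exists (x, b).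
by rewrite mem_bands; case: b.
Qed.

Lemma uniq_letters : uniq letters.
Proof. by apply: allpairs_uniq => [||[x b] [y c] _ _ [-> ->]]; rewrite ?uniq_bands. Qed.

Lemma uniq_oletters : uniq oletters.
Proof.
rewrite /= map_inj_uniq ?uniq_letters ?andbT; last by move=> l l' [].
by apply/mapP => -[].
Qed.

Lemma oindex_lt ol : (oindex ol < size oletters)%N.
Proof. by rewrite index_mem mem_oletters. Qed.

Lemma nth_oindex ol : nth None oletters (oindex ol) = ol.
Proof. by rewrite nth_index ?mem_oletters. Qed.

Lemma pbandsE : pbands n g =
  [seq (enc_band x, (8 * tail x, 8 * Defs.head x)%N) | x <- bands].
Proof.
by rewrite /pbands /bands !map_cat -!(val_enum_ord) -!map_comp.
Qed.

Lemma plettersE : pletters n g = map letter_code letters.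
Proof.
rewrite /pletters pbandsE /letters -map_comp.
by elim: bands => //= x s IH; rewrite IH.
Qed.

Lemma number_letters : number_codes (pletters n g) = map ocode oletters.
Proof.
rewrite /number_codes plettersE /= size_map; congr (_ :: _).
apply: (@eq_from_nth _ (0%N, [::])) => [|i]; first by rewrite !size_map size_iota.
rewrite size_map size_iota => lti.
rewrite (nth_map 0%N) ?size_iota // nth_iota // add0n.
have [l0 _] : exists l : lettr, True by case: letters lti => // l; exists l.
rewrite -map_comp (nth_map l0) //= (nth_map l0) // /ocode; congr pair.
by rewrite /oindex /= index_map ?index_uniq ?uniq_letters // => l l' [].
Qed.

End Letters.

Section Tables.
Variable R : realType.
Local Notation C := (complex R).

(* The matrices number 1, 2, 3 and 4, 5, 6 are the letters of the two words, and
   7, .., 12 those of their product at the intersection point.  The factor 1/2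
   compensates for the antisymmetrization over all pairs of generators. *)
Definition half_bracket (x : nat -> 'M[C]_2) : C :=
  2^-1 * (\tr (mx_word x (iota 7 6))
          - 2^-1 * tr3 x (1, 2, 3)%N * tr3 x (4, 5, 6)%N).

(** The table depends neither on the surface nor on the loops; [c] will be the sign of an
    intersection. *)
Lemma bracket_table (c : rat) : exists tab : tpoly, forall x : nat -> 'M[C]_2,
  x 0%N = 1%:M -> eval_tpoly x tab = ratr c * half_bracket x.
Proof.
have half_in : ratr 2^-1 = 2^-1 :> C by rewrite fmorphV rmorph_nat.
have [tab Htab] := texpr_scale c (texpr_scale 2^-1 (texpr_sub (texpr_word C (iota 7 6))
  (texpr_scale 2^-1 (texpr_mul (texpr_tr3 C (1, 2, 3)%N) (texpr_tr3 C (4, 5, 6)%N))))).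
by exists tab => x x0; rewrite -Htab // !half_in /half_bracket -!mulrA.
Qed.

End Tables.

(** * The polynomial computed for two words evaluates to half their Goldman sum *)

Section Correctness.
Variables (R : realType) (o : bool) (n g : nat).
Local Notation C := (complex R).
Local Notation lettr := (band n g * bool)%type.
Local Notation oletter := (option lettr).
Local Notation ols := (oletters n g).
Implicit Types (rho : rep R n g) (T : oletter * oletter * oletter).

Definition oword (ol : oletter) : word n g := if ol is Some l then [:: l] else [::].
Definition word3 T : word n g := oword T.1.1 ++ oword T.1.2 ++ oword T.2.

Definition triples : seq (oletter * oletter * oletter) :=
  [seq (p, c) | p <- [seq (a, b) | a <- ols, b <- ols], c <- ols].

Definition index_of T : nat :=
  index3 (size ols) (oindex T.1.1, oindex T.1.2, oindex T.2).

Definition no_letters : oletter * oletter * oletter := (None, None, None).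

Lemma size_triples : size triples = (size ols * size ols * size ols)%N.
Proof. by rewrite !size_allpairs. Qed.

Lemma index3_lt K i j k : (i < K)%N -> (j < K)%N -> (k < K)%N ->
  (index3 K (i, j, k) < K * K * K)%N.
Proof. by rewrite /index3 /=; nia. Qed.

Lemma index_of_lt T : (index_of T < size triples)%N.
Proof. by rewrite size_triples index3_lt ?oindex_lt. Qed.

Lemma nth_index_of T : nth no_letters triples (index_of T) = T.
Proof.
have lt2 : (oindex T.1.1 * size ols + oindex T.1.2 < size [seq (a, b) | a <- ols, b <- ols])%N.
  by rewrite size_allpairs; have := oindex_lt T.1.1; have := oindex_lt T.1.2; nia.
have -> : index_of T =
  ((oindex T.1.1 * size ols + oindex T.1.2) * size ols + oindex T.2)%N by [].
rewrite /triples (nth_allpairs _ _ (None, None) None) ?oindex_lt //.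
rewrite (nth_allpairs _ _ None None) ?oindex_lt // !nth_oindex.
by case: T {lt2} => -[].
Qed.

Lemma uniq_triples : uniq triples.
Proof.
apply: allpairs_uniq => [||[p c] [p' c'] _ _ [-> ->]] //; last exact: uniq_oletters.
by apply: allpairs_uniq => [||[a b] [a' b'] _ _ [-> ->]] //; apply: uniq_oletters.
Qed.

Lemma index_of_nth i : (i < size triples)%N -> index_of (nth no_letters triples i) = i.
Proof.
move=> lti; apply/eqP.
by rewrite -(nth_uniq no_letters _ _ uniq_triples) ?index_of_lt // nth_index_of.
Qed.

Definition ocode3 T : code3 := (ocode T.1.1, ocode T.1.2, ocode T.2).

Lemma ptriplesE : ptriples (map (@ocode n g) ols) = map ocode3 triples.
Proof.
have pairsE : [seq (a, b) | a <- map (@ocode n g) ols, b <- map (@ocode n g) ols] =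
    map (fun p => (ocode p.1, ocode p.2)) [seq (a, b) | a <- ols, b <- ols].
  by rewrite allpairs_map2 map_allpairs.
by rewrite /ptriples pairsE allpairs_map2 /triples [RHS]map_allpairs.
Qed.

Definition omx rho (ol : oletter) : 'M[C]_2 := if ol is Some l then letter_mx rho l else 1%:M.

Lemma tr_word3 T rho : tr (word3 T) rho = \tr (omx rho T.1.1 *m omx rho T.1.2 *m omx rho T.2).
Proof.
have omxE ol : word_mx rho (oword ol) = omx rho ol.
  by case: ol => [l|] /=; rewrite ?word_mx_cons word_mx_nil ?mulmx1.
by rewrite /tr /word3 !word_mx_cat !omxE mulmxA.
Qed.

(* The strands of the two loops have pairwise distinct offsets. *)
Definition ostrand (ol : oletter) (k : nat) : seq (nstrand n g) :=
  if ol is Some l then [:: (l, k)] else [::].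
Definition loopU T := ostrand T.1.1 1 ++ ostrand T.1.2 2 ++ ostrand T.2 3.
Definition loopV T := ostrand T.1.1 4 ++ ostrand T.1.2 5 ++ ostrand T.2 6.

Definition strand_code (s : nstrand n g) : pstrand :=
  (oindex (Some s.1), (exit8 s, entry8 s)).

Lemma pstr_code ol k : (k <= 8)%N -> pstr (ocode ol) k (8 - k) = map strand_code (ostrand ol k).
Proof. by case: ol => [[x []]|]. Qed.

Lemma ploopUE T : ploopU (ocode3 T) = map strand_code (loopU T).
Proof. by rewrite /loopU !map_cat -!pstr_code. Qed.

Lemma ploopVE T : ploopV (ocode3 T) = map strand_code (loopV T).
Proof. by rewrite /loopV !map_cat -!pstr_code. Qed.

Lemma pchordE r : pchord (map strand_code r) = chord (@entry8 n g) (@exit8 n g) r.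
Proof. by rewrite /pchord /chord -!map_comp. Qed.

Definition oenv T1 T2 (r r' : seq (nstrand n g)) : seq oletter :=
  [:: None; T1.1.1; T1.1.2; T1.2; T2.1.1; T2.1.2; T2.2] ++ [seq Some s.1 | s <- r ++ r'].

Lemma penvE T1 T2 r r' :
  penv (ocode3 T1) (ocode3 T2) (map strand_code r) (map strand_code r') =
  map (@oindex n g) (oenv T1 T2 r r').
Proof. by rewrite /penv /oenv /= !map_cat -!map_comp. Qed.

Variable z : nat -> rfun R n g.
Hypothesis zE : forall T, z (index_of T) = tr (word3 T).

Lemma eval_psubst (env : seq oletter) tab rho :
  eval_fpoly z (psubst (size ols) (map (@oindex n g) env) tab) rho =
  eval_tpoly (fun k => omx rho (nth None env k)) tab.
Proof.
rewrite /eval_fpoly /eval_tpoly big_map; apply: eq_bigr => m _ /=.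
congr (_ * _); rewrite big_map; apply: eq_bigr => t _.
have nthE k : nth 0%N (map (@oindex n g) env) k = oindex (nth None env k).
  have [lt|ge] := ltnP k (size env); first by rewrite (nth_map None).
  by rewrite !nth_default ?size_map.
rewrite !nthE -[index3 _ _]/(index_of (nth None env _, nth None env _, nth None env _)).
by rewrite zE tr_word3.
Qed.

(** Positions past the end of [w] give the blank, whose matrix is the identity, so reading [m]
    letters instead of [size w] changes nothing. *)
Lemma mx_word_oenv rho (p : seq oletter) (w : word n g) m : (size w <= m)%N ->
  mx_word (fun k => omx rho (nth None (p ++ map Some w) k)) (iota (size p) m) = word_mx rho w.
Proof.
elim: m p w => [|m IH] p w; first by case: w => // _; rewrite mx_word_nil word_mx_nil.
rewrite mx_word_cons nth_cat ltnn subnn.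
case: w => [|l w] le.
  rewrite mul1mx -(IH (rcons p None) [::] isT) size_rcons; apply: eq_bigr => k _.
  rewrite /= !cats0 nth_rcons; case: ltngtP => // [lt|->]; rewrite nth_default //.
  exact: ltnW.
rewrite word_mx_cons; congr (_ *m _).
by rewrite -(IH (rcons p (Some l)) w) // size_rcons cat_rcons.
Qed.

Lemma eval_half_bracket T1 T2 r r' rho : (size (r ++ r') <= 6)%N ->
  half_bracket (fun k => omx rho (nth None (oenv T1 T2 r r') k)) =
  2^-1 * (tr (map fst (r ++ r')) rho - 2^-1 * tr (word3 T1) rho * tr (word3 T2) rho).
Proof.
move=> le6; have := @mx_word_oenv rho
  [:: None; T1.1.1; T1.1.2; T1.2; T2.1.1; T2.1.2; T2.2] (map fst (r ++ r')) 6.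
rewrite size_map -map_comp => /(_ le6) wordE.
by rewrite /half_bracket !tr_word3 [tr (map fst _) _]/tr -wordE.
Qed.

Variables tabp tabm : tpoly.
Let sgn : C := if o then 1 else -1.
Hypothesis tabpE : forall x : nat -> 'M[C]_2, x 0%N = 1%:M ->
  eval_tpoly x tabp = sgn * half_bracket x.
Hypothesis tabmE : forall x : nat -> 'M[C]_2, x 0%N = 1%:M ->
  eval_tpoly x tabm = - sgn * half_bracket x.

Lemma map_fst_ostrand ol k : map fst (ostrand ol k) = oword ol.
Proof. by case: ol. Qed.

Lemma map_fst_loopU T : map fst (loopU T) = word3 T.
Proof. by rewrite /loopU !map_cat !map_fst_ostrand. Qed.

Lemma map_fst_loopV T : map fst (loopV T) = word3 T.
Proof. by rewrite /loopV !map_cat !map_fst_ostrand. Qed.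

Lemma size_word3 T : (size (word3 T) <= 3)%N.
Proof. by case: T => -[[?|] [?|]] [?|]. Qed.

Lemma size_rots (A : eqType) (u r : seq A) : r \in rots u -> size r = size u.
Proof. by case/mapP => i _ ->; rewrite size_rot. Qed.

Lemma eval_pbracket T1 T2 rho :
  eval_fpoly z (pbracket tabp tabm (size ols) (ocode3 T1) (ocode3 T2)) rho =
  2^-1 * goldman_sum o (map (@to_strand n g) (loopU T1)) (map (@to_strand n g) (loopV T2)) rho.
Proof.
have le8 ol k : (k <= 8)%N -> all (fun s => s.2 <= 8)%N (ostrand ol k).
  by case: ol => //= l ->.
rewrite goldman_sum_rots ?all_cat ?le8 // map_fst_loopU map_fst_loopV.
rewrite /eval_fpoly /pbracket ploopUE ploopVE !map_rots mulr_sumr.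
rewrite [LHS]big_flatten [LHS]big_map [LHS]big_map.
apply: eq_big_seq => r ru; rewrite [LHS]big_flatten [LHS]big_map [LHS]big_map mulr_sumr.
apply: eq_big_seq => r' rv; rewrite !pchordE penvE.
have x0 : omx rho (nth None (oenv T1 T2 r r') 0) = 1%:M by [].
have le6 : (size (r ++ r') <= 6)%N.
  rewrite size_cat (size_rots ru) (size_rots rv).
  by rewrite -(size_map fst) -(size_map fst (loopV _)) map_fst_loopU map_fst_loopV;
    apply: (leq_add (size_word3 T1) (size_word3 T2)).
rewrite mulrCA /nsign -(eval_half_bracket T1 T2 rho le6).
set d := chord _ _ r; set d' := chord _ _ r'.
(* The chords cross exactly when the two end points of the second lie on different sides of the
   first; the mixed cases are the signs +1 and -1. *)
case: (nleft d d'.2); case: (nleft d d'.1); cbv iota.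
- by rewrite big_nil subrr mulr0 mul0r.
- rewrite -/(eval_fpoly z _ rho) eval_psubst tabpE // subr0 mulr1.
  by rewrite /sgn; case: (o); rewrite ?rmorph1 ?rmorphN1.
- rewrite -/(eval_fpoly z _ rho) eval_psubst tabmE // sub0r mulrN1.
  by rewrite /sgn; case: (o); rewrite ?opprK ?rmorph1 ?rmorphN1.
- by rewrite big_nil subrr mulr0 mul0r.
Qed.

End Correctness.

Lemma enc_seq_map (A B : Type) (f : B -> tree) (h : A -> B) s :
  enc_seq f (map h s) = enc_seq (f \o h) s.
Proof. by elim: s => //= x s ->. Qed.

Lemma eq_enc_seq (A : Type) (f h : A -> tree) (p : pred A) s :
  all p s -> (forall x, p x -> f x = h x) -> enc_seq f s = enc_seq h s.
Proof. by move=> ps fh; elim: s ps => //= x s IH /andP[/fh -> /IH ->]. Qed.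

Lemma enc_pairE (A B : Type) (eA : Enc A) (eB : Enc B) (a : A) (b : B) :
  enc (a, b) = Node (enc a) (enc b).
Proof. by []. Qed.

(** * The output of the program as a Poisson bi-vector *)

Section BivectorOutput.
Variables (R : realType) (o : bool) (n g : nat) (tabp tabm : tpoly).
Local Notation C := (complex R).
Local Notation oletter := (option (band n g * bool)).
Implicit Types T : oletter * oletter * oletter.
Local Notation ols := (oletters n g).
Local Notation trips := (triples n g).
Let N := size trips.

Let ith (i : nat) := nth (no_letters n g) trips i.

Definition gen_words : N.-tuple (word n g) := map_tuple (@word3 n g) (in_tuple trips).

Lemma N_gt0 : (0 < N)%N. Proof. exact: leq_trans (index_of_lt (no_letters n g)). Qed.

(** The program handles plain numbers, the specification elements of ['I_N]. Out-of-range numbers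
    would go to 0, but [bracket_of_small] shows that none occurs. *)
Definition toI (k : nat) : 'I_N := insubd (Ordinal N_gt0) k.

Lemma val_toI k : (k < N)%N -> toI k = k :> nat.
Proof. by move=> ltk; rewrite val_insubd ltk. Qed.

Definition toI_fpoly (p : fpoly nat) : fpoly 'I_N := [seq (m.1, map toI m.2) | m <- p].

Definition bracket_of T1 T2 : fpoly nat :=
  pbracket tabp tabm (size ols) (@ocode3 n g T1) (ocode3 T2).

Definition out_bivector : bivector 'I_N :=
  [seq (toI_fpoly (bracket_of T1 T2), (toI (index_of T1), toI (index_of T2)))
  | T1 <- trips, T2 <- trips].

Definition small (m : rat * seq nat) : bool := all (fun k => k < N)%N m.2.

Lemma psubst_small (env : seq (option (band n g * bool))) tab :
  all small (psubst (size ols) (map (@oindex n g) env) tab).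
Proof.
rewrite all_map; apply/allP => m _ /=; rewrite /small all_map; apply/allP => t _ /=.
have nth_lt k : (nth 0%N (map (@oindex n g) env) k < size ols)%N.
  have [lt|ge] := ltnP k (size env); first by rewrite (nth_map None) ?oindex_lt.
  by rewrite nth_default ?size_map.
by rewrite /N size_triples index3_lt.
Qed.

Lemma bracket_of_small T1 T2 : all small (bracket_of T1 T2).
Proof.
rewrite /bracket_of /pbracket ploopUE ploopVE !map_rots.
apply/allP => m /flattenP[_ /mapP[_ /mapP[r _ ->] ->]].
move=> /flattenP[_ /mapP[_ /mapP[r' _ ->] ->]]; rewrite penvE.
by case: ifP => _; case: ifP => _ //; apply/allP: m; apply: psubst_small.
Qed.

Lemma enc_toI_fpoly p : all small p ->
  enc_seq (enc_pair enc_rat (enc_seq (@enc_ord N))) (toI_fpoly p) = enc p.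
Proof.
move=> sp; rewrite enc_seq_map; apply: (eq_enc_seq sp) => m sm.
rewrite /= /enc_pair /=; congr (Node _ _); rewrite enc_seq_map.
by apply: (eq_enc_seq sm) => k /val_toI kE; rewrite /= /enc_ord kE.
Qed.

Lemma enc_output : let cs := number_codes (pletters n g) in
  enc (poutput tabp tabm cs) =
  Node (enc_seq (@enc_word n g) gen_words) (enc_bivector (@enc_ord N) out_bivector).
Proof.
move=> cs; rewrite /poutput /cs number_letters ptriplesE size_map.
rewrite enc_pairE; congr (Node _ _).
  rewrite -[LHS]/(enc_seq _ _) -[tval _]/(map _ _) !enc_seq_map.
  apply: (eq_enc_seq (all_predT _)) => T _ /=.
  by case: T => -[[?|] [?|]] [?|].
rewrite /out_bivector /enc_bivector allpairs_map2.
(* Both double lists become images of the same list of pairs, so that their encodings are compared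
   element by element. *)
have pairsE (A B B' : Type) (f : A -> A -> B) (h : B -> B') s t :
  [seq h (f a b) | a <- s, b <- t] = map h [seq f a b | a <- s, b <- t] :> seq B'.
  by rewrite map_allpairs.
rewrite (pairsE _ _ _ pair (fun q => (pbracket tabp tabm (size ols) (ocode3 q.1) (ocode3 q.2),
  (pindex (size ols) (ocode3 q.1), pindex (size ols) (ocode3 q.2))))).
rewrite (pairsE _ _ _ pair (fun q => (toI_fpoly (bracket_of q.1 q.2),
  (toI (index_of q.1), toI (index_of q.2))))).
rewrite -[LHS]/(enc_seq _ _) !enc_seq_map.
apply/esym/(eq_enc_seq (all_predT _)) => -[T1 T2] _.
rewrite /= /enc_pair /= enc_toI_fpoly ?bracket_of_small //.
by rewrite /enc_ord !val_toI ?index_of_lt.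
Qed.

Hypothesis tabpE : forall x : nat -> 'M[C]_2, x 0%N = 1%:M ->
  eval_tpoly x tabp = (if o then 1 else -1) * half_bracket x.
Hypothesis tabmE : forall x : nat -> 'M[C]_2, x 0%N = 1%:M ->
  eval_tpoly x tabm = - (if o then 1 else -1) * half_bracket x.

Let z (i : 'I_N) : rfun R n g := tr (tnth gen_words i).

Lemma tnth_gen_words i : tnth gen_words i = word3 (ith i).
Proof. by rewrite tnth_map (tnth_nth (no_letters n g)). Qed.

Lemma z_index_of T : z (toI (index_of T)) = tr (word3 T).
Proof. by rewrite /z tnth_gen_words val_toI ?index_of_lt // /ith nth_index_of. Qed.

(** Each ordered pair of generators has exactly one term, so a coefficient collects the term of (i,
    j) and, by antisymmetry of the wedge, minus that of (j, i). *)
Lemma eval_out_coef i j rho :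
  bivector_coef z out_bivector i j rho =
  eval_fpoly z (toI_fpoly (bracket_of (ith i) (ith j))) rho
  - eval_fpoly z (toI_fpoly (bracket_of (ith j) (ith i))) rho.
Proof.
have bigN (F : _ -> C) : \sum_(T <- trips) F T = \sum_(i < N) F (ith i).
  by rewrite (big_nth (no_letters n g)) big_mkord.
have toI_nth (k : 'I_N) : toI (index_of (ith k)) = k.
  by apply: ord_inj; rewrite val_toI ?index_of_lt // /ith index_of_nth.
rewrite /bivector_coef big_allpairs_dep bigN /=.
pose G (k l : 'I_N) := eval_fpoly z (toI_fpoly (bracket_of (ith k) (ith l))) rho.
transitivity (\sum_(k < N) \sum_(l < N)
    (((k, l) == (i, j))%:R - ((k, l) == (j, i))%:R) * G k l).
  by apply: eq_bigr => k _; rewrite bigN; apply: eq_bigr => l _; rewrite !toI_nth.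
rewrite pair_bigA /= -/(G i j) -/(G j i).
have single k l : \sum_p (p == (k, l))%:R * G p.1 p.2 = G k l.
  rewrite (bigD1 (k, l)) //= eqxx mul1r big1 ?addr0 // => p /negbTE ->.
  by rewrite mul0r.
rewrite -(single i j) -(single j i) -sumrB; apply: eq_bigr => -[k l] _.
by rewrite /= mulrBl.
Qed.

Lemma eval_toI_fpoly T1 T2 rho :
  eval_fpoly z (toI_fpoly (bracket_of T1 T2)) rho =
  2^-1 * goldman_sum o (map (@to_strand n g) (loopU T1)) (map (@to_strand n g) (loopV T2)) rho.
Proof.
rewrite -(@eval_pbracket R o n g (fun k => z (toI k)) z_index_of tabp tabm tabpE tabmE).
rewrite /eval_fpoly big_map; apply: eq_bigr => m _; congr (_ * _).
by rewrite big_map.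
Qed.

Lemma general_position_loops T1 T2 :
  general_position (map (@to_strand n g) (loopU T1)) (map (@to_strand n g) (loopV T2)).
Proof.
apply: general_position_offsets; case: T1 => -[[?|] [?|]] [?|]; by case: T2 => -[[?|] [?|]] [?|].
Qed.

Lemma out_poisson_bivector : poisson_bivector o (enum 'I_N) z out_bivector.
Proof.
split=> [i _|f|B gB i j _ _ rho]; first exact: coord_ring_tr.
  move=> /coord_ring_trace_fun; apply: gen_trans => _ [w ->].
  apply: gen_trans (tr_short R w) => _ [v [v3 _ ->]].
  have [T ->] : exists T, v = word3 T.
    case: v v3 => [|a [|b [|c [|//]]]] _.
    - by exists (None, None, None).
    - by exists (Some a, None, None).
    - by exists (Some a, Some b, None).
    - by exists (Some a, Some b, Some c).
  by apply: gen_in; exists (toI (index_of T)); rewrite ?mem_enum ?z_index_of.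
have bracketE (k l : 'I_N) : eval_fpoly z (toI_fpoly (bracket_of (ith k)
    (ith l))) rho = 2^-1 * B (z k) (z l) rho.
  rewrite eval_toI_fpoly -(goldman_trace gB) ?general_position_loops //.
  have wordE s : loop_word (map (@to_strand n g) s) = map fst s.
    by rewrite /loop_word -map_comp.
  by rewrite !wordE map_fst_loopU map_fst_loopV /z !tnth_gen_words.
(* Each of the two terms is half a bracket; antisymmetry adds them up to the full bracket. *)
rewrite eval_out_coef !bracketE.
have -> : B (z j) (z i) rho = - B (z i) (z j) rho.
  by apply: (goldman_anti gB); apply: coord_ring_tr.
have two : 2^-1 + 2^-1 = 1 :> C by rewrite -mulr2n -[_ *+ 2]mulr_natr mulVf ?pnatr_eq0.
by rewrite mulrN opprK -mulrDl two mul1r.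
Qed.

End BivectorOutput.

Lemma algorithm_exists (R : realType) (o : bool) :
  exists p, @effective_bivector_algorithm R o p.
Proof.
have [tabp Hp] := bracket_table R (if o then 1 else -1).
have [tabm Hm] := bracket_table R (- (if o then 1 else -1)).
have [p Cp] : computable (fun e : nat * nat =>
    poutput tabp tabm (number_codes (pletters e.1 e.2))).
  apply: (computable_app (computable_poutput tabp tabm)).
  exact: (computable_number_codes (computable_fst computable_id) (computable_snd computable_id)).
exists p => n g.
exists (size (triples n g)), (gen_words n g), (out_bivector n g tabp tabm).
split; first by rewrite -enc_output; apply: (Cp (n, g)).
apply: out_poisson_bivector => x x0; rewrite ?Hp ?Hm //; case: (o).
all: by rewrite ?opprK ?rmorph1 ?rmorphN1.
Qed.

(** * The five-holed sphere *)

Definition valid50 (I : seq nat) : bool := all (fun i => 0 < i < 5)%N I.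

Section TraceRelations.
Variable F : fieldType.
Implicit Types A B C : 'M[F]_2.

(** Cayley-Hamilton polarized once: the two cyclic orders of three matrices have traces whose sum is
    a polynomial in shorter traces. *)
Lemma tr_swap A B C : \tr (A *m C *m B) =
  - \tr (A *m B *m C) + \tr A * \tr (B *m C) + \tr B * \tr (A *m C)
  + \tr C * \tr (A *m B) - \tr A * \tr B * \tr C.
Proof. by rewrite !tr2 !mul2E; ring. Qed.

Lemma tr_sqr A B : \tr (A *m A *m B) = \tr A * \tr (A *m B) - \det A * \tr B.
Proof. by rewrite !tr2 !mul2E det2; ring. Qed.

End TraceRelations.

Section Generators50.
Variable R : realType.
Local Notation C := (complex R).
Implicit Types (rho : rep R 5 0) (I J : seq nat).

Definition gen50 : rfun R 5 0 -> Prop :=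
  generated (fun h => exists2 I, I \in index50 & h = @t50 R I).

Let X rho i := letter_mx rho (c50 i).

Lemma t50E I : @t50 R I = fun rho => \tr (mx_word (X rho) I).
Proof. by apply: funext => rho /=; rewrite /t50 /tr /word_mx big_map. Qed.

Lemma gen50_in I : I \in index50 -> gen50 (@t50 R I).
Proof. by move=> iI; apply: gen_in; exists I. Qed.

Lemma t50_1 i : @t50 R [:: i] = fun rho => \tr (X rho i).
Proof. by rewrite t50E; apply: funext => rho /=; rewrite mx_word_cons mx_word_nil mulmx1. Qed.

Lemma t50_2 i j : @t50 R [:: i; j] = fun rho => \tr (X rho i *m X rho j).
Proof. by rewrite t50E; apply: funext => rho /=; rewrite !mx_word_cons mx_word_nil mulmx1. Qed.

Lemma t50_3 i j k : @t50 R [:: i; j; k] = fun rho => \tr (X rho i *m X rho j *m X rho k).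
Proof.
by rewrite t50E; apply: funext => rho /=; rewrite !mx_word_cons mx_word_nil mulmx1 mulmxA.
Qed.

Lemma det_X rho i : \det (X rho i) = 1.
Proof. exact: det_letter_mx. Qed.

Lemma gen50_1 i : (0 < i < 5)%N -> gen50 (@t50 R [:: i]).
Proof. by move=> vi; apply: gen50_in; case: i vi => [|[|[|[|[|//]]]]]. Qed.

Lemma gen50_2 i j : (0 < i < 5)%N -> (0 < j < 5)%N -> gen50 (@t50 R [:: i; j]).
Proof.
wlog: i j / (i <= j)%N => [H vi vj|].
  have [le|/ltnW le] := leqP i j; first exact: H.
  apply: gen_ext (H _ _ le vj vi) => rho.
  by rewrite !t50_2 mxtrace_mulC.
rewrite leq_eqVlt => /orP[/eqP <- vi _|lt vi vj].
  apply: gen_ext (gen_sub (gen_mul (gen50_1 vi) (gen50_1 vi)) (gen_const _ 2)) => rho.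
  have := tr_sqr (X rho i) 1%:M.
  by rewrite t50_1 t50_2 !mulmx1 det_X mxtrace1 mul1r.
have : [:: i; j] \in index50.
  by case: i lt vi => [|[|[|[|[|//]]]]] //; case: j vj => [|[|[|[|[|//]]]]].
exact: gen50_in.
Qed.

Lemma gen50_rot i j k : gen50 (@t50 R [:: i; j; k]) -> gen50 (@t50 R [:: j; k; i]).
Proof.
by apply: gen_ext => rho; rewrite !t50_3 -mulmxA mxtrace_mulC.
Qed.

Lemma gen50_swap i j k : (0 < i < 5)%N -> (0 < j < 5)%N -> (0 < k < 5)%N ->
  gen50 (@t50 R [:: i; j; k]) -> gen50 (@t50 R [:: i; k; j]).
Proof.
move=> vi vj vk H.
have := gen_sub (gen_add (gen_add (gen_add (gen_opp H)
  (gen_mul (gen50_1 vi) (gen50_2 vj vk))) (gen_mul (gen50_1 vj) (gen50_2 vi vk)))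
  (gen_mul (gen50_1 vk) (gen50_2 vi vj)))
  (gen_mul (gen_mul (gen50_1 vi) (gen50_1 vj)) (gen50_1 vk)).
by apply: gen_ext => rho; rewrite !t50_3 !t50_2 !t50_1 -tr_swap.
Qed.

Lemma gen50_sqr i j : (0 < i < 5)%N -> (0 < j < 5)%N -> gen50 (@t50 R [:: i; i; j]).
Proof.
move=> vi vj.
have := gen_sub (gen_mul (gen50_1 vi) (gen50_2 vi vj)) (gen50_1 vj).
by apply: gen_ext => rho; rewrite t50_3 t50_2 !t50_1 tr_sqr det_X mul1r.
Qed.

(** Cyclic rotations and [gen50_swap] sort the three indices; a repeated index is then removed by
    Cayley-Hamilton, and distinct sorted indices are generators. *)
Lemma gen50_3 i j k : (0 < i < 5)%N -> (0 < j < 5)%N -> (0 < k < 5)%N ->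
  gen50 (@t50 R [:: i; j; k]).
Proof.
wlog: i j k / (i <= j)%N => [H vi vj vk|].
  have [le|/ltnW le] := leqP i j; first exact: H.
  by apply: gen50_rot; apply: gen50_swap => //; do 2!apply: gen50_rot; apply: H.
wlog: i j k / (j <= k)%N => [H le vi vj vk|].
  have [le'|/ltnW le'] := leqP j k; first exact: H.
  have [le2|/ltnW le2] := leqP i k.
    by apply: gen50_swap => //; apply: H.
  by apply: gen50_rot; apply: H.
rewrite leq_eqVlt => /orP[/eqP <-|ltjk].
  by move=> _ vi vj _; do 2!apply: gen50_rot; apply: gen50_sqr.
rewrite leq_eqVlt => /orP[/eqP <-|ltij] vi vj vk; first exact: gen50_sqr.
apply: gen50_in; case: i ltij vi => [|[|[|[|[|//]]]]] //;
  case: j ltjk vj => [|[|[|[|[|//]]]]] //; by case: k vk => [|[|[|[|[|//]]]]].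
Qed.

Lemma gen50_word I : valid50 I -> gen50 (@t50 R I).
Proof.
move=> vI; apply: gen_trans (tr_short R [seq c50 i | i <- I]).
move=> _ [v [v3 vsub ->]].
have [J vJ vE] : exists2 J, valid50 J & v = [seq c50 i | i <- J].
  elim: v vsub {v3} => [|l v IH] sub; first by exists [::].
  have [J vJ ->] : exists2 J, valid50 J & v = [seq c50 i | i <- J].
    by apply: IH => l' lv; apply: sub; rewrite inE lv orbT.
  have /mapP[i iI ->] := sub l (mem_head _ _).
  by exists (i :: J) => //=; rewrite (allP vI).
have : (size J <= 3)%N by move: v3; rewrite vE size_map.
rewrite vE; case: J vJ {v3 vsub vE} => [|i [|j [|k [|//]]]] /= vJ _.
- by apply: gen_ext (gen_const _ 2) => rho; rewrite /tr word_mx_nil mxtrace1.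
- by apply: gen50_1; move: vJ; rewrite andbT.
- by case/and3P: vJ => vi vj _; apply: gen50_2.
- by case/and4P: vJ => vi vj vk _; apply: gen50_3.
Qed.

(** The module spanned by the positive words in c_1, .., c_4 over the algebra of the 14 generators.
    It is closed under products and adjugates, and so contains the matrices of all words, including
    inverses and c_5; its traces lie in the algebra. *)
Inductive span50 : (rep R 5 0 -> 'M[C]_2) -> Prop :=
| span_word I : valid50 I -> span50 (fun rho => mx_word (X rho) I)
| span_scale f M : gen50 f -> span50 M -> span50 (fun rho => f rho *: M rho)
| span_add M N : span50 M -> span50 N -> span50 (fun rho => M rho + N rho).

Lemma span_ext M N : M =1 N -> span50 M -> span50 N.
Proof. by move=> /funext ->. Qed.

Lemma span_mul M N : span50 M -> span50 N -> span50 (fun rho => M rho *m N rho).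
Proof.
move=> SM SN; elim: SM => {M} [I vI|f M gf _ IH|M M' _ IH _ IH'].
- elim: SN => {N} [J vJ|f N gf _ IH|N N' _ IH _ IH'].
  + apply: span_ext (@span_word (I ++ J) _) => [rho|].
      by rewrite mx_word_cat.
    by rewrite /valid50 all_cat -!/(valid50 _) vI vJ.
  + by apply: span_ext (span_scale gf IH) => rho; rewrite -scalemxAr.
  + by apply: span_ext (span_add IH IH') => rho; rewrite mulmxDr.
- by apply: span_ext (span_scale gf IH) => rho; rewrite -scalemxAl.
- by apply: span_ext (span_add IH IH') => rho; rewrite mulmxDl.
Qed.

Lemma span_tr M : span50 M -> gen50 (fun rho => \tr (M rho)).
Proof.
elim=> {M} [I /gen50_word|f M gf _ IH|M N _ IH _ IH'].
- by rewrite t50E.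
- by apply: gen_ext (gen_mul gf IH) => rho; rewrite mxtraceZ.
- by apply: gen_ext (gen_add IH IH') => rho; rewrite mxtraceD.
Qed.

Lemma span_adj M : span50 M -> span50 (fun rho => adj2 (M rho)).
Proof.
move=> SM; have S1 := @span_word [::] isT.
apply: span_ext (span_add (span_scale (span_tr SM) S1)
  (span_scale (gen_const _ (-1)) SM)) => rho.
by rewrite mx_word_nil /adj2 scaleN1r scalemx1.
Qed.

Lemma span_letter l : span50 (fun rho => letter_mx rho l).
Proof.
suff h x : span50 (fun rho => letter_mx rho (x, true)).
  case: l => x []; first exact: h.
  by apply: span_ext (span_adj (h x)) => rho; rewrite -letter_mx_adj.
case: x => [[[]//|[]//]|j].
have [lt4|ge4] := ltnP j 4.
  apply: span_ext (@span_word [:: j.+1] _) => [rho|]; last by rewrite /valid50 /= ltnS lt4.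
  by rewrite mx_word_cons mx_word_nil mulmx1 /X /c50 /= inord_val.
(* The remaining letter is c_5, the inverse of c_1 c_2 c_3 c_4 by the relator. *)
apply: span_ext (span_adj (@span_word [:: 1; 2; 3; 4]%N isT)) => rho.
pose c5 := (inr j : band 5 0, true).
have j4 : j = inord 4 by apply: val_inj; rewrite /= inordK //; have := ltn_ord j; lia.
have relE : relator 5 0 = [seq c50 i | i <- [:: 1; 2; 3; 4]%N] ++ [:: c5].
  rewrite /relator enum_ord0 /= /c5 j4 /c50 /band_c /=.
  suff -> : enum 'I_5 = [:: inord 0; inord 1; inord 2; inord 3; inord 4] by [].
  apply: (inj_map val_inj); rewrite val_enum_ord /=.
  by rewrite !inordK.
have := rep_relator rho; rewrite relE word_mx_cat (word_mx_cons _ c5) word_mx_nil mulmx1.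
rewrite /word_mx big_map -/(mx_word (X rho) _); set A := mx_word _ _ => AL.
have dA : \det A = 1.
  by rewrite /A /mx_word -(big_map c50 xpredT (letter_mx rho)); apply: det_word_mx.
rewrite -invmx_adj2 //; have uA : A \in unitmx by rewrite unitmxE dA unitr1.
by apply: (can_inj (mulKmx uA)); rewrite mulmxV.
Qed.

Lemma coord_ring_gen50 f : coord_ring f -> gen50 f.
Proof.
move=> /coord_ring_trace_fun; apply: gen_trans => _ [w ->].
apply: (span_tr (M := fun rho => word_mx rho w)); elim: w => [|l w IH].
  by apply: span_ext (@span_word [::] isT) => rho; rewrite mx_word_nil word_mx_nil.
by apply: span_ext (span_mul (span_letter l) IH) => rho; rewrite word_mx_cons.
Qed.

End Generators50.

(** * Computation with integer polynomials in the entries of four matrices *)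

Notation ipol := (Pol Z).
(** The sparse Horner polynomials behind the [ring] tactic: they can be computed with, and their
    evaluation lemmas are those of the tactic. *)
Definition padd : ipol -> ipol -> ipol := Padd Z0 Z.add Zeq_bool.
Definition psub : ipol -> ipol -> ipol := Psub Z0 Z.add Z.sub Z.opp Zeq_bool.
Definition pmul : ipol -> ipol -> ipol := Pmul Z0 (Zpos 1) Z.add Z.mul Zeq_bool.
Definition pvar (j : positive) : ipol := mk_X Z0 (Zpos 1) j.
Definition psum (T : Type) (f : T -> ipol) (s : seq T) : ipol :=
  foldr (fun x q => padd (f x) q) (Pc Z0) s.

Definition Z_of_int (m : int) : Z :=
  match m with Posz k => Z.of_nat k | Negz k => Z.opp (Z.of_nat k.+1) end.

(* 2 x 2 matrices, row by row.  The entries a, d, b, c of the i-th generic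
   matrix (i > 0) are the variables number 4 i - 3, .., 4 i: MFactor only finds
   the monomial a d if its variables are adjacent. *)
Definition ipmx : Type := (ipol * ipol * ipol * ipol)%type.

Definition pmulmx (A B : ipmx) : ipmx :=
  let '(a, b, c, d) := A in let '(a', b', c', d') := B in
  (padd (pmul a a') (pmul b c'), padd (pmul a b') (pmul b d'),
   padd (pmul c a') (pmul d c'), padd (pmul c b') (pmul d d')).

Definition pgen (i : nat) : ipmx :=
  let p := Pos.of_nat (4 * i - 3) in
  (pvar p, pvar (Pos.add p 2), pvar (Pos.add p 3), pvar (Pos.add p 1)).

Definition ipword (w : seq nat) : ipmx :=
  foldr (fun i => pmulmx (pgen i)) (Pc (Zpos 1), Pc Z0, Pc Z0, Pc (Zpos 1)) w.

Definition ptr (w : seq nat) : ipol := let '(a, b, c, d) := ipword w in padd a d.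

(** The rewriting rules a d = 1 + b c, one for each of the first [k] generic matrices. *)
Definition det_rules (k : nat) : seq (Z * Mon * ipol) :=
  pmap (fun i => let p := Pos.of_nat (4 * i - 3) in
    omap (fun m => (m, padd (Pc (Zpos 1)) (pmul (pvar (Pos.add p 2)) (pvar (Pos.add p 3)))))
      (mon_of_pol Z0 Zeq_bool (pmul (pvar p) (pvar (Pos.add p 1))))) (iota 1 k).

(** The two numbers 20 bound the amount of rewriting. Soundness holds for any bounds; these let all
    the differences below reach zero. *)
Definition preduce (P : ipol) : ipol :=
  PNSubstL Z0 (Zpos 1) Z.add Z.mul Zeq_bool Z.quotrem P (det_rules 4) 20 20.

Section Eval.
Variable F : fieldType.

Lemma Frth : ring_theory (0 : F) 1 +%R *%R (fun x y => x - y) -%R eq.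
Proof.
split=> //; [exact: add0r | exact: addrC | exact: addrA | exact: mul1r
  | exact: mulrC | exact: mulrA | exact: mulrDl | exact: subrr].
Qed.

Let Req : RelationClasses.Equivalence (@eq F) := RelationClasses.eq_equivalence.
Let Rext := Eq_ext (+%R : F -> F -> F) *%R -%R.
Let Rarth := Rth_ARth Req Rext Frth.
Let phi : Z -> F := gen_phiZ 0 1 +%R *%R -%R.
Let Rmorph := gen_phiZ_morph Req Rext Frth.

Lemma phi_int m : phi (Z_of_int m) = m%:~R.
Proof.
have phi_nat k : phi (Z.of_nat k) = k%:R.
  elim: k => [|k IH]; first exact: (morph0 Rmorph).
  rewrite Nat2Z.inj_succ -Z.add_1_r [phi _](morph_add Rmorph) -/phi IH -natr1.
  by congr (_ + _); exact: (morph1 Rmorph).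
case: m => k; first exact: phi_nat.
by rewrite NegzE mulrNz -[_%:~R]phi_nat; exact: (morph_opp Rmorph).
Qed.

Variable l : seq F.
Definition pev (P : ipol) : F := Pphi 0 +%R *%R (gen_phiZ 0 1 +%R *%R -%R) l P.
Arguments pev : simpl never.

Lemma pev_add P Q : pev (padd P Q) = pev P + pev Q.
Proof. exact: (Padd_ok Req Rext Rarth Rmorph). Qed.

Lemma pev_sub P Q : pev (psub P Q) = pev P - pev Q.
Proof. exact: (Psub_ok Req Rext Rarth Rmorph). Qed.

Lemma pev_mul P Q : pev (pmul P Q) = pev P * pev Q.
Proof. exact: (Pmul_ok Req Rext Rarth Rmorph). Qed.

Lemma pev_int m : pev (Pc (Z_of_int m)) = m%:~R.
Proof. exact: phi_int. Qed.

Lemma pev0 : pev (Pc Z0) = 0.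
Proof. exact: (pev_int 0). Qed.

Lemma pev1 : pev (Pc (Zpos 1)) = 1.
Proof. exact: (pev_int 1). Qed.

Lemma pev_var j : pev (pvar j) = BinList.nth 0 j l.
Proof. by rewrite /pev /pvar -(mkX_ok Req Rext Rarth Rmorph). Qed.

Lemma pev_sum T (f : T -> ipol) s : pev (psum f s) = \sum_(x <- s) pev (f x).
Proof.
elim: s => [|x s IH]; first by rewrite big_nil pev0.
by rewrite big_cons /= pev_add IH.
Qed.

Definition pevmx (A : ipmx) : 'M[F]_2 :=
  let '(a, b, c, d) := A in
  \matrix_(i, j) if i == 0 then if j == 0 then pev a else pev b
                 else if j == 0 then pev c else pev d.

Lemma pevmx_mul A B : pevmx (pmulmx A B) = pevmx A *m pevmx B.
Proof.
case: A => [[[a b] c] d]; case: B => [[[a' b'] c'] d'].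
by apply: matrix2P; rewrite mul2E !mxE /= pev_add !pev_mul.
Qed.

Variable M : nat -> 'M[F]_2.

Lemma pevmx_word w : (forall i, i \in w -> pevmx (pgen i) = M i) ->
  pevmx (ipword w) = \big[mulmx/1%:M]_(i <- w) M i.
Proof.
elim: w => [|i w IH] gen.
  by rewrite big_nil; apply: matrix2P; rewrite !mxE /= ?pev0 ?pev1.
rewrite big_cons -[ipword _]/(pmulmx (pgen i) (ipword w)) pevmx_mul gen ?mem_head // IH // => j jw.
by apply: gen; rewrite inE jw orbT.
Qed.

Lemma pev_tr w : (forall i, i \in w -> pevmx (pgen i) = M i) ->
  pev (ptr w) = \tr (\big[mulmx/1%:M]_(i <- w) M i).
Proof.
move=> /pevmx_word <-; rewrite /ptr; case: (ipword w) => [[[a b] c] d].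
by rewrite tr2 !mxE pev_add.
Qed.

Lemma preduce_eq P Q : preduce (psub P Q) = Pc Z0 ->
  MPcond 0 1 +%R *%R eq (gen_phiZ 0 1 +%R *%R -%R) (det_rules 4) l ->
  pev P = pev Q.
Proof.
move=> red rules; apply/eqP; rewrite -subr_eq0 -pev_sub; apply/eqP.
rewrite -[RHS]pev0 -red.
exact (PNSubstL_ok Req Rext Rarth Rmorph (Ztriv_div_th Req phi) 20 20 _ (psub P Q) l rules).
Qed.

End Eval.

(** The entries come in the order a, d, b, c of the variables in [pgen]. *)
Definition valuation (F : fieldType) (M : nat -> 'M[F]_2) : seq F :=
  [:: M 1%N 0 0; M 1%N 1 1; M 1%N 0 1; M 1%N 1 0;
      M 2%N 0 0; M 2%N 1 1; M 2%N 0 1; M 2%N 1 0;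
      M 3%N 0 0; M 3%N 1 1; M 3%N 0 1; M 3%N 1 0;
      M 4%N 0 0; M 4%N 1 1; M 4%N 0 1; M 4%N 1 0].

Lemma pevmx_gen (F : fieldType) (M : nat -> 'M[F]_2) i :
  (0 < i < 5)%N -> pevmx (valuation M) (pgen i) = M i.
Proof.
case: i => [|[|[|[|[|//]]]]] // _;
  by apply: matrix2P; rewrite mxE !pev_var.
Qed.

Lemma valuation_rules (F : fieldType) (M : nat -> 'M[F]_2) :
  (forall i, \det (M i) = 1) ->
  MPcond 0 1 +%R *%R eq (gen_phiZ 0 1 +%R *%R -%R) (det_rules 4) (valuation M).
Proof.
move=> dM.
have dE i : M i 0 0 * M i 1 1 = 1 + M i 0 1 * M i 1 0 by rewrite -(dM i) det2 subrK.
(* The left-hand side is the monomial a d with its coefficient, in the shape in which [MPcond]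
   evaluates it. *)
have rule i P : P = 1 + M i 0 1 * M i 1 0 -> 1 * (1 * M i 1 1 * M i 0 0) = P.
  by move=> ->; rewrite -dE; ring.
by split; [apply: (rule 1%N) | split; [apply: (rule 2%N) | split; [apply: (rule 3%N)
  | split; [apply: (rule 4%N) | by []]]]];
  rewrite -/(pev _ _) pev_add pev_mul !pev_var pev1.
Qed.

(* A strand (i, k) runs along the band c_i, from the tail to the head, starting
   at offset k / 8. *)
Definition c50_index (i : nat) : nat := if (i.-1 < 5)%N then i.-1 else 0.
Definition exit50 (s : nat * nat) : nat := 8 * (2 * c50_index s.1) + s.2.
Definition entry50 (s : nat * nat) : nat := 8 * (2 * c50_index s.1 + 1) + (8 - s.2).
Definition strands50 (k : nat) (I : seq nat) : seq (nat * nat) := zip I (iota k (size I)).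

(* Twice the bracket {t_I, t_J} for the orientation opposite to the plane. *)
Definition bracket50 (I J : seq nat) : ipol :=
  let u := strands50 1 I in let v := strands50 4 J in
  psum (fun r => psum (fun r' =>
    let d := chord entry50 exit50 r in let d' := chord entry50 exit50 r' in
    pmul (Pc (Z_of_int (nsign false d d')))
      (psub (pmul (Pc (Z_of_int 2)) (ptr (map fst (r ++ r')))) (pmul (ptr I) (ptr J))))
    (rots v)) (rots u).

(** Twice the polynomial. The coefficients are half-integers, as [valid_fpoly50] verifies, so taking
    the numerator after doubling is exact. *)
Definition fpoly50 (p : fpoly (seq nat)) : ipol :=
  psum (fun m => pmul (Pc (Z_of_int (numq (2 * m.1))))
                      (foldr (fun I => pmul (ptr I)) (Pc (Zpos 1)) m.2)) p.

Definition coef50 (I J : seq nat) : ipol :=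
  psum (fun t => pmul (Pc (Z_of_int ((t.2 == (I, J))%:Z - (t.2 == (J, I))%:Z)))
                      (fpoly50 t.1)) bivector50.

Definition valid_fpoly50 (p : fpoly (seq nat)) : bool :=
  all (fun m => (2 * m.1 == (numq (2 * m.1))%:~R) && all valid50 m.2) p.

Lemma valid_bivector50 : all (fun t => valid_fpoly50 t.1) bivector50.
Proof. by vm_compute. Qed.

(** All 196 ordered pairs of generators are checked, including those whose bracket is zero: modulo
    the determinant relations, twice the Goldman sum minus twice the coefficient reduces to the zero
    polynomial. *)
Lemma bracket50_coef50 :
  all (fun I => all (fun J =>
    if preduce (psub (bracket50 I J) (coef50 I J)) is Pc Z0 then true else false)
    index50) index50.
Proof. by vm_compute. Qed.

Arguments pev : simpl never.

(** * From the computed identities to the brackets of the five-holed sphere *)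

Section Sigma50.
Variable R : realType.
Local Notation C := (complex R).
Implicit Types (rho : rep R 5 0) (I J : seq nat).

Lemma tr50 I rho :
  tr [seq c50 i | i <- I] rho = \tr (\big[mulmx/1%:M]_(i <- I) letter_mx rho (c50 i)).
Proof. by rewrite /tr /word_mx big_map. Qed.

Let val rho := valuation (fun i => letter_mx rho (c50 i)).

Lemma pev_tr50 I rho : valid50 I -> pev (val rho) (ptr I) = tr [seq c50 i | i <- I] rho.
Proof.
move=> /allP vI; rewrite tr50; apply: pev_tr => i /vI.
exact: (@pevmx_gen _ (fun i => letter_mx rho (c50 i))).
Qed.

Lemma pev_fpoly50 p rho : valid_fpoly50 p ->
  pev (val rho) (fpoly50 p) = 2 * eval_fpoly (@t50 R) p rho.
Proof.
rewrite /eval_fpoly pev_sum big_distrr /=; elim: p => [|m p IH] /=; first by rewrite !big_nil.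
case/andP=> /andP[/eqP cm vm] vp; rewrite !big_cons IH //; congr (_ + _).
rewrite pev_mul pev_int mulrA; congr (_ * _).
  by rewrite -ratr_int -cm rmorphM /= ratr_nat.
elim: (m.2) vm => [|I s IHs] /=; first by rewrite big_nil pev1.
by case/andP=> vI vs; rewrite big_cons pev_mul IHs // pev_tr50.
Qed.

Lemma pev_coef50 I J rho :
  pev (val rho) (coef50 I J) = 2 * bivector_coef (@t50 R) bivector50 I J rho.
Proof.
rewrite /bivector_coef pev_sum big_distrr /=; apply: eq_big_seq => t tb.
rewrite pev_mul pev_int pev_fpoly50; last exact: (allP valid_bivector50).
by rewrite intrB -!pmulrn mulrCA.
Qed.

Definition nstrand50 (s : nat * nat) : nstrand 5 0 := (c50 s.1, s.2).

Lemma chord50 r :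
  chord (@entry8 5 0) (@exit8 5 0) (map nstrand50 r) = chord entry50 exit50 r.
Proof.
have idx i : (inord i.-1 : 'I_5) = c50_index i :> nat.
  rewrite /c50_index; case: ifP => [lt5|ge5]; first by rewrite inordK.
  by rewrite /inord val_insubd ge5.
rewrite chord_map; congr pair; congr (_ 0%N _); apply: eq_map => -[i k] /=.
  by rewrite /entry50 /entry8 /head8 /= idx.
by rewrite /exit50 /exit8 /tail8 /= idx.
Qed.

Lemma map_fst_strands50 k I : map fst (strands50 k I) = I.
Proof. by rewrite -/(unzip1 _) unzip1_zip // size_iota. Qed.

Lemma pev_bracket50 I J rho : I \in index50 -> J \in index50 ->
  pev (val rho) (bracket50 I J) =
  2 * goldman_sum false (map (@to_strand 5 0) (map nstrand50 (strands50 1 I)))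
                        (map (@to_strand 5 0) (map nstrand50 (strands50 4 J))) rho.
Proof.
move=> /(allP (isT : all (fun I => valid50 I && (size I <= 3))%N index50)) /andP[vI sI].
move=> /(allP (isT : all (fun I => valid50 I && (size I <= 3))%N index50)) /andP[vJ sJ].
have small k K : (k + size K <= 9)%N -> all (fun s => s.2 <= 8)%N (map nstrand50 (strands50 k K)).
  move=> le9; rewrite all_map; apply/allP => -[i o] /= /(map_f snd) /=.
  rewrite -/(unzip2 _) unzip2_zip ?size_iota // mem_iota; lia.
rewrite goldman_sum_rots ?small //; [|lia..].
rewrite pev_sum map_rots big_distrr [RHS]big_map /=; apply: eq_big_seq => r ru.
rewrite pev_sum map_rots big_distrr [RHS]big_map /=; apply: eq_big_seq => r' rv.
rewrite pev_mul pev_int !chord50 mulrCA; congr (_ * _).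
have fst50 w : map fst (map nstrand50 w) = map c50 (map fst w) by rewrite -!map_comp.
have vsub k K w : valid50 K -> w \in rots (strands50 k K) -> valid50 (map fst w).
  move=> /allP vK /mapP[i _ ->]; apply/allP => j; rewrite map_rot mem_rot map_fst_strands50.
  exact: vK.
rewrite -map_cat fst50 !fst50 !map_fst_strands50 -[Zpos 2]/(Z_of_int 2).
rewrite pev_sub !pev_mul pev_int !pev_tr50 //.
  by field.
by rewrite map_cat /valid50 all_cat -!/(valid50 _) !(vsub _ _ _ _ ru, vsub _ _ _ _ rv).
Qed.

Lemma bracket50E (B : rfun R 5 0 -> rfun R 5 0 -> rfun R 5 0) I J rho :
  goldman_bracket false B -> I \in index50 -> J \in index50 ->
  B (@t50 R I) (@t50 R J) rho = bivector_coef (@t50 R) bivector50 I J rho.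
Proof.
move=> gB iI iJ.
have two : (2 : C) != 0 by rewrite pnatr_eq0.
(* Doubling clears the halves, so that both sides are values of integer polynomials at the entries
   of the four matrices. *)
apply: (mulfI two); rewrite -pev_coef50.
have -> : pev (val rho) (coef50 I J) = pev (val rho) (bracket50 I J).
  apply/esym/preduce_eq; last by apply: valuation_rules => i; apply: det_letter_mx.
  have /allP /(_ _ iI) /allP /(_ _ iJ) := bracket50_coef50.
  by case: preduce => // -[].
have loopE k K : loop_word (map (@to_strand 5 0) (map nstrand50 (strands50 k K))) =
    [seq c50 i | i <- K].
  by rewrite -[in RHS](map_fst_strands50 k K) /loop_word -!map_comp.
rewrite pev_bracket50 // -(goldman_trace gB) ?loopE //.
(* The first loop uses offsets among 1, 2, 3 and the second among 4, 5, 6, in units of 1/8. *)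
have /allP /(_ _ iI) /allP /(_ _ iJ) : all (fun I => all (fun J =>
    let s := map snd (strands50 1 I ++ strands50 4 J) in
    all (fun k => 0 < k < 8)%N s && uniq s) index50) index50 by [].
move=> /andP[in8 un]; apply: general_position_offsets.
  by rewrite -map_cat all_map; rewrite all_map in in8.
by rewrite -map_cat -map_comp.
Qed.

End Sigma50.

Local Close Scope ring_scope.

Theorem theorem3 (R : realType) :
  (forall o : bool, exists p : prog, @effective_bivector_algorithm R o p) /\
  (exists o : bool, @poisson_bivector R 5 0 o (seq nat) index50 (@t50 R) bivector50).
Proof.
split; first exact: algorithm_exists.
(* The signs of the stated bi-vector are those of the orientation opposite to that of the plane. *)
exists false; split=> [I _|f Hf|B gB I J iI iJ rho].
- exact: coord_ring_tr.
- exact: coord_ring_gen50.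
- exact: bracket50E.
Qed.
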